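(* If on a 4-manifold there exists a (local) hyper-paracomplex structure, then the corresponding neutral conformal structure is anti-self-dual (on the domain where the hyper-paracomplex structure is defined).
   Context: A hyper-paracomplex structure on a 4-manifold is a triple $(J_1,J_2,J_3)$ of endomorphisms of the tangent bundle with $J_1^2=J_2^2=-J_3^2=\mathrm{id}$, $J_1J_2=-J_2J_1=J_3$, each of which is integrable (vanishing Nijenhuis tensor). The corresponding neutral conformal structure is the conformal class of the compatible metrics $g$, i.e. those with $g(J_1\cdot,J_1\cdot)=g(J_2\cdot,J_2\cdot)=-g(J_3\cdot,J_3\cdot)=-g(\cdot,\cdot)$ (they have signature $(2,2)$). The orientation is the one for which the 2-forms $F_\alpha(X,Y)=g(X,J_\alpha Y)$, $\alpha=1,2,3$, are self-dual. The conformal structure is anti-self-dual if the self-dual part $W^+$ of its Weyl tensor vanishes. *)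

(* Defs.v *)
From HB Require Import structures.
From mathcomp Require Import all_boot all_order all_algebra.
From mathcomp Require Import all_classical all_reals all_analysis.

Set Implicit Arguments.
Unset Strict Implicit.
Unset Printing Implicit Defensive.

Import Order.TTheory GRing.Theory Num.Theory.
Import numFieldNormedType.Exports.

Local Open Scope classical_set_scope.
Local Open Scope ring_scope.

(* Points and tangent vectors of R^4 are column vectors, so that a matrix acts
   on tangent vectors by [A *m v] and composition of endomorphisms is [*m]. *)
Notation vec4 R := ('cV[R]_4).

Section Calculus.
Context {R : realType}.
Implicit Types (V : set (vec4 R)) (f : vec4 R -> R).

Definition e_ (i : 'I_4) : vec4 R := delta_mx i 0.

Definition partial (i : 'I_4) f : vec4 R -> R := fun x => 'D_(e_ i) f x.

Fixpoint Ck (k : nat) V f : Prop :=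
  (forall x, V x -> {for x, continuous f}) /\
  if k is k'.+1 then
    forall i, (forall x, V x -> derivable f x (e_ i)) /\ Ck k' V (partial i f)
  else True.

(* For [V] open. *)
Definition smooth V f : Prop := forall k, Ck k V f.

Definition smooth_mx m n V (A : vec4 R -> 'M[R]_(m, n)) : Prop :=
  forall i j, smooth V (fun x => A x i j).

Definition lie_bracket (X Y : vec4 R -> vec4 R) : vec4 R -> vec4 R := fun x =>
  \col_k \sum_l (X x l 0 * partial l (fun y => Y y k 0) x
                 - Y x l 0 * partial l (fun y => X y k 0) x).

Definition nijenhuis (J : vec4 R -> 'M[R]_4) (X Y : vec4 R -> vec4 R) :
    vec4 R -> vec4 R := fun x =>
  let JX y := J y *m X y in let JY y := J y *m Y y in
  lie_bracket JX JY x - J x *m lie_bracket JX Y x - J x *m lie_bracket X JY x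
  + J x *m J x *m lie_bracket X Y x.

End Calculus.

(* [g] is the matrix of a metric in a coordinate domain of R^4.  Conventions:
   R(d_i, d_j) d_k = Riem^l_{kij} d_l,  Ric_{kj} = Riem^i_{kij}. *)
Section Curvature.
Context {R : realType}.
Variable g : vec4 R -> 'M[R]_4.

Definition christoffel (k i j : 'I_4) : vec4 R -> R := fun x =>
  2^-1 * \sum_l invmx (g x) k l *
    (partial i (fun y => g y j l) x + partial j (fun y => g y i l) x
     - partial l (fun y => g y i j) x).

Definition riemann_up (l k i j : 'I_4) : vec4 R -> R := fun x =>
  partial i (christoffel l j k) x - partial j (christoffel l i k) x
  + \sum_m (christoffel l i m x * christoffel m j k x
            - christoffel l j m x * christoffel m i k x).

Definition riemann (a k i j : 'I_4) : vec4 R -> R := fun x =>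
  \sum_l g x a l * riemann_up l k i j x.

Definition ricci (k j : 'I_4) : vec4 R -> R := fun x =>
  \sum_i riemann_up i k i j x.

Definition scalar_curvature : vec4 R -> R := fun x =>
  \sum_k \sum_j invmx (g x) k j * ricci k j x.

Definition weyl (a b c d : 'I_4) : vec4 R -> R := fun x =>
  riemann a b c d x
  - 2^-1 * (g x a c * ricci b d x - g x a d * ricci b c x
            + g x b d * ricci a c x - g x b c * ricci a d x)
  + 6^-1 * scalar_curvature x * (g x a c * g x b d - g x a d * g x b c).

End Curvature.

Section Hodge.
Context {R : realType}.

Definition levi_civita (a b c d : 'I_4) : R :=
  \det (\matrix_(r < 4, s < 4) (tnth [tuple a; b; c; d] r == s)%:R).

(* Hodge star on 2-forms, a 2-form being its antisymmetric matrix of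
   components; [g] is the matrix of the metric at a point, and [o] is 1 or -1
   according to whether the coordinate frame is positively oriented. *)
Definition hodge (g : 'M[R]_4) (o : R) (w : 'M[R]_4) : 'M[R]_4 :=
  \matrix_(a, b) (2^-1 * \sum_c \sum_d
    o * Num.sqrt `|\det g| * levi_civita c d a b
    * (invmx g *m w *m (invmx g)^T) c d).

Definition self_dual (g : 'M[R]_4) (o : R) (w : 'M[R]_4) : Prop :=
  hodge g o w = w.

(* W^+ = (W + * W) / 2, the Weyl tensor being regarded as an endomorphism of
   the bundle of 2-forms. *)
Definition weyl_plus (g : vec4 R -> 'M[R]_4) (o : R) (a b c d : 'I_4)
    (x : vec4 R) : R :=
  2^-1 * (weyl g a b c d x
          + hodge (g x) o (\matrix_(a', b') weyl g a' b' c d x) a b).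

End Hodge.

(* [param] is only meaningful on the image of the chart. *)
Record chart (R : realType) (T : topologicalType) := Chart {
  dom : set T;
  coord : T -> vec4 R;
  param : vec4 R -> T;
  dom_open : open dom;
  image_open : open (coord @` dom);
  coordK : forall p, dom p -> param (coord p) = p;
  coord_continuous : forall p, dom p -> {for p, continuous coord};
  param_continuous : forall x, (coord @` dom) x -> {for x, continuous param}
}.

Record manifold4 (R : realType) := Manifold4 {
  carrier :> topologicalType;
  manifold_hausdorff : hausdorff_space carrier;
  manifold_second_countable : @second_countable carrier;
  index : Type;
  atlas : index -> chart R carrier;
  atlas_cover : forall p : carrier, exists i, dom (atlas i) p;
  atlas_smooth : forall i j,
    smooth_mx (coord (atlas i) @` (dom (atlas i) `&` dom (atlas j)))
      (fun x => coord (atlas j) (param (atlas i) x))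
}.

(* A tensor field with two indices: [t i p] is the matrix of its components at
   [p] in the chart [i].  The transformation laws are imposed below, according
   to the variance; components outside the chart are irrelevant. *)
Definition field2 (R : realType) (M : manifold4 R) : Type :=
  index M -> M -> 'M[R]_4.

Section Tensors.
Context {R : realType} {M : manifold4 R}.
Implicit Types (U : set M) (i j : index M) (p : M).

Definition local_dom U i : set (vec4 R) :=
  coord (atlas i) @` (U `&` dom (atlas i)).

Definition local_rep {A : Type} (t : index M -> M -> A) i : vec4 R -> A :=
  fun x => t i (param (atlas i) x).

Definition transition_jac i j p : 'M[R]_4 :=
  \matrix_(a, b) partial b (fun x => coord (atlas j) (param (atlas i) x) a 0)
                   (coord (atlas i) p).

Definition smooth_field U (t : field2 M) : Prop :=
  forall i, smooth_mx (local_dom U i) (local_rep t i).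

Definition endomorphism_field U (J : field2 M) : Prop :=
  smooth_field U J /\
  forall i j p, U p -> dom (atlas i) p -> dom (atlas j) p ->
    J j p *m transition_jac i j p = transition_jac i j p *m J i p.

Definition metric_on U (g : field2 M) : Prop :=
  [/\ smooth_field U g,
      forall i j p, U p -> dom (atlas i) p -> dom (atlas j) p ->
        g i p = (transition_jac i j p)^T *m g j p *m transition_jac i j p,
      forall i p, U p -> dom (atlas i) p -> (g i p)^T = g i p
    & forall i p, U p -> dom (atlas i) p -> g i p \in unitmx].

Definition orientation_on U (o : index M -> M -> R) : Prop :=
  [/\ forall i p, U p -> dom (atlas i) p -> o i p = 1 \/ o i p = -1,
      forall i j p, U p -> dom (atlas i) p -> dom (atlas j) p ->
        o j p = Num.sg (\det (transition_jac i j p)) * o i p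
    & forall i p, U p -> dom (atlas i) p -> {for p, continuous (o i)}].

Definition integrable_on U (J : field2 M) : Prop :=
  forall i (X Y : vec4 R -> vec4 R),
    smooth_mx (local_dom U i) X -> smooth_mx (local_dom U i) Y ->
    forall x, local_dom U i x -> nijenhuis (local_rep J i) X Y x = 0.

Record hyper_paracomplex U (J1 J2 J3 : field2 M) : Prop := HyperParacomplex {
  hpc_field1 : endomorphism_field U J1;
  hpc_field2 : endomorphism_field U J2;
  hpc_field3 : endomorphism_field U J3;
  hpc_algebra : forall i p, U p -> dom (atlas i) p ->
    [/\ J1 i p *m J1 i p = 1%:M, J2 i p *m J2 i p = 1%:M,
        J3 i p *m J3 i p = - 1%:M, J1 i p *m J2 i p = J3 i p
      & J2 i p *m J1 i p = - J3 i p];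
  hpc_integrable1 : integrable_on U J1;
  hpc_integrable2 : integrable_on U J2;
  hpc_integrable3 : integrable_on U J3
}.

Definition compatible_metric U (J1 J2 J3 g : field2 M) : Prop :=
  metric_on U g /\
  forall i p, U p -> dom (atlas i) p ->
    [/\ (J1 i p)^T *m g i p *m J1 i p = - g i p,
        (J2 i p)^T *m g i p *m J2 i p = - g i p
      & (J3 i p)^T *m g i p *m J3 i p = g i p].

(* F(X, Y) = g(X, J Y). *)
Definition fundamental_form (g J : field2 M) : field2 M :=
  fun i p => g i p *m J i p.

Definition compatible_orientation U (J1 J2 J3 g : field2 M)
    (o : index M -> M -> R) : Prop :=
  orientation_on U o /\
  forall i p, U p -> dom (atlas i) p ->
    [/\ self_dual (g i p) (o i p) (fundamental_form g J1 i p),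
        self_dual (g i p) (o i p) (fundamental_form g J2 i p)
      & self_dual (g i p) (o i p) (fundamental_form g J3 i p)].

Definition anti_self_dual_metric U (g : field2 M) (o : index M -> M -> R) :
    Prop :=
  forall i p, U p -> dom (atlas i) p -> forall a b c d,
    weyl_plus (local_rep g i) (o i p) a b c d (coord (atlas i) p) = 0.

(* The conformal class of compatible metrics always has local representatives,
   but a compatible metric on all of [D] need not exist, since compatible
   metrics at a point are determined only up to a nonzero, possibly negative,
   factor; hence the quantification over open subsets [U] of [D]. *)
Definition anti_self_dual_structure D (J1 J2 J3 : field2 M) : Prop :=
  forall U (g : field2 M) (o : index M -> M -> R),
    open U -> U `<=` D ->
    compatible_metric U J1 J2 J3 g -> compatible_orientation U J1 J2 J3 g o ->
    anti_self_dual_metric U g o.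

End Tensors.

(* Main.v *)
Require Import Defs.
From mathcomp Require Import all_boot all_order all_algebra.
From mathcomp Require Import all_classical all_reals all_analysis.
From mathcomp Require Import ring lra.

Set Implicit Arguments.
Unset Strict Implicit.
Unset Printing Implicit Defensive.

Import Order.TTheory GRing.Theory Num.Theory.
Import numFieldNormedType.Exports.
(* [index], [coord] and [dom] would otherwise denote library constants. *)
Import Defs.

Local Open Scope classical_set_scope.
Local Open Scope ring_scope.

(* Integrability of the three structures yields the Obata connection D, torsion
   free with D J_a = 0.  Any metric compatible with the J_a is determined up to
   a scalar, so D g = tau g for a 1-form tau: D is a Weyl connection, and the
   Levi-Civita curvature is Q + 1/2 d tau + g ^ K, with Q the curvature of D and
   ^ a Kulkarni-Nomizu product.  As Q commutes with the J_a, the Bianchi identity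
   makes its Ricci form skew and of type (1,1) for each J_a, while the metric
   identifies this form with - d tau.  Hence the Ricci tensor absorbs the
   symmetric part of K, and the Weyl tensor is W = Q + 1/2 d tau + 1/4 g ^ d tau.
   Finally tr (J_a W(X, Y)) = 0 for each a, so W(X, Y), as a 2-form, is
   orthogonal to the F_a, which span the self-dual forms. *)

(** * Paraquaternionic linear algebra and the Obata connection *)

(** Tensors at a point are matrices of components, and their derivatives are further matrices tied
    to them by differentiated identities; the core of the argument is thereby linear algebra. The
    connection D and the form tau are explicit expressions in first derivatives of the J_a and of g.
    They are differentiated only once, and mixed second derivatives are exchanged only for the J_a,
    which gives the commutation with Q, and for g, which gives the trace part of Q. As tau need not
    be closed, K is not symmetric: its skew part is 1/4 d tau, the origin of the last coefficient in
    W. That the F_a span the self-dual forms is not obtained by counting dimensions. If g J_0 is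
    self-dual and the form g X is orthogonal to it, a polarized Pfaffian identity gives J_0 Y = - X
    J_0, where g Y is the Hodge dual of g X. The three instances of this relation force Y = - X. The
    same relations show that a symmetric form compatible with the J_a is a multiple of g. *)

Section MatrixArithmetic.
Context {R : realFieldType} {m n : nat}.
Implicit Types A B C D : 'M[R]_(m, n).

(** Deduces an equation from a known one by exhibiting their difference as a linear identity, which
    [mx_linear] then checks. *)
Lemma eq_from_sub A B C D : A = B -> C - D = A - B -> C = D.
Proof. by move=> ->; rewrite subrr => /eqP; rewrite subr_eq0 => /eqP. Qed.

Lemma mxE_add A B i j : (A + B) i j = A i j + B i j. Proof. by rewrite mxE. Qed.
Lemma mxE_opp A i j : (- A) i j = - A i j. Proof. by rewrite mxE. Qed.
Lemma mxE_scale c A i j : (c *: A) i j = c * A i j. Proof. by rewrite mxE. Qed.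
Lemma mxE_zero i j : (0 : 'M[R]_(m, n)) i j = 0. Proof. by rewrite mxE. Qed.
Definition mxE_lin := (mxE_zero, mxE_add, mxE_opp, mxE_scale).

End MatrixArithmetic.

Ltac mx_distr := rewrite ?(mulmxDl, mulmxDr, mulmxBl, mulmxBr, mulNmx, mulmxN,
  scalerDr, scalerN, opprD, opprK, mulmx1, mul1mx, =^~ scalemxAl, =^~ scalemxAr, mulmxA).

(** Entries of fully distributed products serve as atoms, so only linear relations between words are
    decided here. *)
Ltac mx_linear := apply/matrixP=> ? ?; rewrite ?mxE_lin; by field.

Section ParaQuaternions.
Context {R : realFieldType} {n : nat}.
Implicit Types (X Y : 'cV[R]_n) (K : 'M[R]_n).

Record paraquaternionic (J1 J2 J3 : 'M[R]_n) : Prop := ParaQuaternionic {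
  pq11 : J1 *m J1 = 1%:M;
  pq22 : J2 *m J2 = 1%:M;
  pq33 : J3 *m J3 = - 1%:M;
  pq12 : J1 *m J2 = J3;
  pq21 : J2 *m J1 = - J3 }.

Variables J1 J2 J3 : 'M[R]_n.
Hypothesis J : paraquaternionic J1 J2 J3.

Lemma pq13 : J1 *m J3 = J2.
Proof. by rewrite -(pq12 J) mulmxA (pq11 J) mul1mx. Qed.
Lemma pq31 : J3 *m J1 = - J2.
Proof. by rewrite -[J3]opprK -(pq21 J) mulNmx -mulmxA (pq11 J) mulmx1. Qed.
Lemma pq23 : J2 *m J3 = - J1.
Proof. by rewrite -[J3]opprK -(pq21 J) mulmxN mulmxA (pq22 J) mul1mx. Qed.
Lemma pq32 : J3 *m J2 = J1.
Proof. by rewrite -(pq12 J) -mulmxA (pq22 J) mulmx1. Qed.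

Section Words.
Context {m : nat}.
Variable W : 'M[R]_(m, n).
(** Words are kept associated to the left, so the multiplication table is restated behind a prefix
    [W] to reach inner pairs. *)
Lemma pqw11 : W *m J1 *m J1 = W. Proof. by rewrite -mulmxA (pq11 J) mulmx1. Qed.
Lemma pqw22 : W *m J2 *m J2 = W. Proof. by rewrite -mulmxA (pq22 J) mulmx1. Qed.
Lemma pqw33 : W *m J3 *m J3 = - W.
Proof. by rewrite -mulmxA (pq33 J) mulmxN mulmx1. Qed.
Lemma pqw12 : W *m J1 *m J2 = W *m J3. Proof. by rewrite -mulmxA (pq12 J). Qed.
Lemma pqw21 : W *m J2 *m J1 = - (W *m J3).
Proof. by rewrite -mulmxA (pq21 J) mulmxN. Qed.
Lemma pqw13 : W *m J1 *m J3 = W *m J2. Proof. by rewrite -mulmxA pq13. Qed.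
Lemma pqw31 : W *m J3 *m J1 = - (W *m J2).
Proof. by rewrite -mulmxA pq31 mulmxN. Qed.
Lemma pqw23 : W *m J2 *m J3 = - (W *m J1).
Proof. by rewrite -mulmxA pq23 mulmxN. Qed.
Lemma pqw32 : W *m J3 *m J2 = W *m J1. Proof. by rewrite -mulmxA pq32. Qed.
End Words.

Definition pqE1 := (pq11 J, pq22 J, pq33 J, pq12 J, pq21 J, pq13, pq31, pq23, pq32).
Definition pqEw {m} := (@pqw11 m, @pqw22 m, @pqw33 m, @pqw12 m, @pqw21 m,
  @pqw13 m, @pqw31 m, @pqw23 m, @pqw32 m).

Ltac pq_simpl := repeat (progress (mx_distr; rewrite ?(pqE1, pqEw, mulNmx, mulmxN, opprK))).

Lemma pq_comm3 K : J1 *m K = K *m J1 -> J2 *m K = K *m J2 -> J3 *m K = K *m J3.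
Proof. by move=> h1 h2; rewrite -(pq12 J) -mulmxA h2 mulmxA h1 mulmxA. Qed.

(** Each [J] is sent to its opposite under conjugation by another one, while [K] is fixed; so each
    trace equals its opposite. *)
Lemma pq_trace_comm K : J1 *m K = K *m J1 -> J2 *m K = K *m J2 ->
  [/\ \tr (J1 *m K) = 0, \tr (J2 *m K) = 0 & \tr (J3 *m K) = 0].
Proof.
move=> h1 h2; have h3 := pq_comm3 h1 h2.
have tr0 (a b : 'M[R]_n) (e : R) : e != 0 -> a *m a = e%:M -> a *m b = - (b *m a) ->
    a *m K = K *m a -> \tr (b *m K) = 0.
  move=> e0 aa ab aK; have : \tr (a *m b *m K *m a) = - \tr (a *m b *m K *m a).
    rewrite {1}ab !mulNmx linearN /=; congr (- _).
    by rewrite -[b *m a *m K]mulmxA aK -!mulmxA [RHS]mxtrace_mulC !mulmxA.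
  rewrite mxtrace_mulC !mulmxA aa -mulmxA mul_scalar_mx linearZ /= => h.
  by apply: (mulfI e0); rewrite mulr0; lra.
have e1 : (1 : R) != 0 by rewrite oner_eq0.
have eN : (-1 : R) != 0 by rewrite oppr_eq0.
split.
- by apply: (tr0 J2) e1 (pq22 J) _ h2; rewrite (pq12 J) (pq21 J).
- by apply: (tr0 J1) e1 (pq11 J) _ h1; rewrite (pq12 J) (pq21 J) opprK.
- by apply: (tr0 J1) e1 (pq11 J) _ h1; rewrite pq13 pq31 opprK.
Qed.

(* A derivation [P] of the algebra spanned by [1, J1, J2, J3] into matrices is
   the commutator with the average of [P q * q^-1] over the basis [q]. *)
Lemma pq_derivation_inner P1 P2 P3 (A := - 4%:R^-1 *: (P1 *m J1 + P2 *m J2 - P3 *m J3)) :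
  P1 *m J1 + J1 *m P1 = 0 -> P2 *m J2 + J2 *m P2 = 0 ->
  P3 = P1 *m J2 + J1 *m P2 -> P3 = - (P2 *m J1 + J2 *m P1) ->
  [/\ P1 = J1 *m A - A *m J1, P2 = J2 *m A - A *m J2 & P3 = J3 *m A - A *m J3].
Proof.
move=> h1 h2 h3 h4.
have a1 : P1 *m J1 = - (J1 *m P1) by apply/eqP; rewrite -addr_eq0 h1.
have a2 : P2 *m J2 = - (J2 *m P2) by apply/eqP; rewrite -addr_eq0 h2.
have w1 (w : 'M[R]_n) : w *m P1 *m J1 = - (w *m J1 *m P1).
  by rewrite -mulmxA a1 mulmxN mulmxA.
have w2 (w : 'M[R]_n) : w *m P2 *m J2 = - (w *m J2 *m P2).
  by rewrite -mulmxA a2 mulmxN mulmxA.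
have e1 : P1 = J1 *m A - A *m J1.
  by rewrite /A h3; pq_simpl; rewrite ?(a1, a2, w1, w2); pq_simpl; mx_linear.
have e2 : P2 = J2 *m A - A *m J2.
  by rewrite /A h4; pq_simpl; rewrite ?(a1, a2, w1, w2); pq_simpl; mx_linear.
split=> //; rewrite h3 e1 e2; pq_simpl; mx_linear.
Qed.

(** * Removing the torsion of a connection that preserves the structures *)

Section Torsion.
Variable T : 'cV[R]_n -> 'M[R]_n.
Hypothesis T_anti : forall X Y, T X *m Y = - (T Y *m X).
(* To be added to a connection preserving the [J]'s, with torsion [T], to make it
   torsion free; read off from the Obata formula
   2 D_X Y = [X, Y] - J1 [J1 X, Y] + J2 [X, J2 Y] + J3 [J1 X, J2 Y]. *)
Definition torsion_correction X := 2^-1 *: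
  (- T X + J1 *m T (J1 *m X) - J2 *m T X *m J2 - J3 *m T (J1 *m X) *m J2).

Hypothesis T1 : forall X Y,
  T (J1 *m X) *m J1 *m Y - J1 *m T (J1 *m X) *m Y - J1 *m T X *m J1 *m Y + T X *m Y = 0.
Hypothesis T2 : forall X Y,
  T (J2 *m X) *m J2 *m Y - J2 *m T (J2 *m X) *m Y - J2 *m T X *m J2 *m Y + T X *m Y = 0.
Hypothesis T3 : forall X Y,
  T (J3 *m X) *m J3 *m Y - J3 *m T (J3 *m X) *m Y - J3 *m T X *m J3 *m Y - T X *m Y = 0.

Lemma mx_ext (A B : 'M[R]_n) : (forall Y : 'cV[R]_n, A *m Y = B *m Y) -> A = B.
Proof.
move=> h; apply/trmx_inj/row_matrixP => i; apply: trmx_inj.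
by rewrite !tr_row !trmxK !colE h.
Qed.

(** The correction is the average of [A] and [J2 *m A *m J2], where [A] is
    [- T X + J1 *m T (J1 *m X)]. *)
Lemma torsion_correction_comm2 X :
  J2 *m torsion_correction X = torsion_correction X *m J2.
Proof. by rewrite /torsion_correction; pq_simpl; mx_linear. Qed.

(** The identity [T1] removes a [J1] standing to the right of [T (J1 *m X)]; as [J3] is [J1 *m J2],
    it also yields a rule for [J3]. The two rules bring both sides to a common normal form. *)
Lemma torsion_correction_comm1 X :
  J1 *m torsion_correction X = torsion_correction X *m J1.
Proof.
have h : T (J1 *m X) *m J1 = J1 *m T (J1 *m X) + J1 *m T X *m J1 - T X.
  apply: mx_ext => Y; apply/eqP; rewrite -subr_eq0 -(T1 X Y); apply/eqP.
  by rewrite !(mulmxDl, mulNmx); mx_linear.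
have h3 : T (J1 *m X) *m J3 = J1 *m T (J1 *m X) *m J2 + J1 *m T X *m J3 - T X *m J2.
  by rewrite -(pq12 J) mulmxA h; mx_distr.
have w1 (w : 'M[R]_n) : w *m T (J1 *m X) *m J1 =
    w *m (J1 *m T (J1 *m X) + J1 *m T X *m J1 - T X) by rewrite -h mulmxA.
have w3 (w : 'M[R]_n) : w *m T (J1 *m X) *m J3 =
    w *m (J1 *m T (J1 *m X) *m J2 + J1 *m T X *m J3 - T X *m J2).
  by rewrite -h3 mulmxA.
rewrite /torsion_correction; pq_simpl; rewrite ?(h, h3, w1, w3); pq_simpl.
mx_linear.
Qed.

Lemma torsion_correction_antisym X Y :
  torsion_correction X *m Y - torsion_correction Y *m X = - (T X *m Y).
Proof.
have h1 : T (J1 *m X) *m J1 *m Y = J1 *m T (J1 *m X) *m Y + J1 *m T X *m J1 *m Y - T X *m Y.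
  by apply: (eq_from_sub (T1 X Y)); mx_linear.
have h2 : T (J2 *m X) *m J2 *m Y = J2 *m T (J2 *m X) *m Y + J2 *m T X *m J2 *m Y - T X *m Y.
  by apply: (eq_from_sub (T2 X Y)); mx_linear.
(* The mixed terms in [J1] and [J2] are governed by [T3] at [J2 X, J2 Y], as
   [J3 J2 = J1]. *)
have := T3 (J2 *m X) (J2 *m Y).
have t1 : T Y *m X = - (T X *m Y) by rewrite T_anti.
have t2 : T Y *m J2 *m X = - (T (J2 *m X) *m Y) by rewrite -mulmxA T_anti.
rewrite /torsion_correction; pq_simpl.
have tw (w : 'M[R]_n) : w *m T Y *m J2 *m X = - (w *m T (J2 *m X) *m Y).
  by rewrite -!mulmxA [T Y *m _]mulmxA t2 mulmxN.
have tw' (w : 'M[R]_n) : w *m T (J1 *m Y) *m X = - (w *m T X *m J1 *m Y).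
  by rewrite -!mulmxA T_anti mulmxN.
have tw4 (w : 'M[R]_n) : w *m T (J1 *m Y) *m J2 *m X = - (w *m T (J2 *m X) *m J1 *m Y).
  by rewrite -!mulmxA [T _ *m _]T_anti mulmxN.
rewrite h1 h2 t1 tw tw' tw4 => e; apply: (eq_from_sub (congr1 ( *:%R 2^-1) e)).
mx_linear.
Qed.

End Torsion.

Definition along (P : 'I_n -> 'M[R]_n) X : 'M[R]_n := \sum_i X i 0 *: P i.

(** The subtracted sum is the matrix of the map taking [Y] to [along A Y *m X]; keeping the second
    argument implicit lets the torsion be composed with the [J]'s. *)
Definition torsion (A : 'I_n -> 'M[R]_n) X : 'M[R]_n :=
  along A X - \sum_j A j *m X *m delta_mx 0 j.

Lemma torsionE A X Y : torsion A X *m Y = along A X *m Y - along A Y *m X.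
Proof.
rewrite /torsion mulmxBl; congr (_ - _); rewrite /along !mulmx_suml.
apply: eq_bigr => j _; rewrite -!mulmxA.
have -> : delta_mx 0 j *m Y = (Y j 0)%:M :> 'M[R]_1.
  apply/matrixP=> a b; rewrite !ord1 !mxE (bigD1 j) //= big1 ?addr0 ?mxE ?eqxx ?mul1r //.
  by move=> k /negbTE kj; rewrite mxE eqxx kj mul0r.
by rewrite mul_mx_scalar -scalemxAr scalemxAl.
Qed.

Lemma along_delta A i : along A (delta_mx i 0) = A i.
Proof.
rewrite /along (bigD1 i) //= big1 ?addr0 ?mxE ?eqxx ?scale1r //.
by move=> k /negbTE ki; rewrite mxE ki scale0r.
Qed.

Lemma along_commutator (K : 'M[R]_n) P A : (forall i, P i = K *m A i - A i *m K) ->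
  forall X, along P X = K *m along A X - along A X *m K.
Proof.
move=> h X; rewrite /along mulmx_sumr mulmx_suml -sumrB; apply: eq_bigr => i _.
by rewrite h scalerBr scalemxAr scalemxAl.
Qed.

(** The last hypothesis is the vanishing of the Nijenhuis tensor on constant fields. As [K] is
    parallel for [A], passing from partial to covariant derivatives leaves only torsion terms. *)
Lemma torsion_nijenhuis K (e : R) P A : K *m K = e%:M ->
  (forall i, P i = K *m A i - A i *m K) ->
  (forall X Y, along P (K *m X) *m Y - along P (K *m Y) *m X
     + K *m along P Y *m X - K *m along P X *m Y = 0) ->
  forall X Y, torsion A (K *m X) *m K *m Y - K *m torsion A (K *m X) *m Y
    - K *m torsion A X *m K *m Y + e *: (torsion A X *m Y) = 0.
Proof.
move=> KK hP hN X Y; move: (hN X Y); rewrite !(along_commutator hP).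
have KKw m (w : 'M[R]_(m, n)) : w *m K *m K = e *: w.
  by rewrite -mulmxA KK mul_mx_scalar.
rewrite -!(mulmxA _ K Y) -!(mulmxA K (torsion _ _)) !torsionE.
mx_distr; rewrite KK !mul_scalar_mx -!scalemxAl => h.
by apply: (eq_from_sub (congr1 -%R h)); mx_linear.
Qed.

Section Obata.
Variables P1 P2 P3 : 'I_n -> 'M[R]_n.

(** The matrix of [pq_derivation_inner] in each direction: under the hypotheses below it preserves
    the [J]'s, but in general it has torsion. *)
Definition pq_connection i : 'M[R]_n :=
  - 4%:R^-1 *: (P1 i *m J1 + P2 i *m J2 - P3 i *m J3).

Definition obata i : 'M[R]_n :=
  pq_connection i + torsion_correction (torsion pq_connection) (delta_mx i 0).

Hypothesis dJ1 : forall i, P1 i *m J1 + J1 *m P1 i = 0.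
Hypothesis dJ2 : forall i, P2 i *m J2 + J2 *m P2 i = 0.
Hypothesis dJ12 : forall i, P3 i = P1 i *m J2 + J1 *m P2 i.
Hypothesis dJ21 : forall i, P3 i = - (P2 i *m J1 + J2 *m P1 i).
Hypothesis N1 : forall X Y, along P1 (J1 *m X) *m Y - along P1 (J1 *m Y) *m X
     + J1 *m along P1 Y *m X - J1 *m along P1 X *m Y = 0.
Hypothesis N2 : forall X Y, along P2 (J2 *m X) *m Y - along P2 (J2 *m Y) *m X
     + J2 *m along P2 Y *m X - J2 *m along P2 X *m Y = 0.
Hypothesis N3 : forall X Y, along P3 (J3 *m X) *m Y - along P3 (J3 *m Y) *m X
     + J3 *m along P3 Y *m X - J3 *m along P3 X *m Y = 0.

Let A := pq_connection.
Let A1 i : P1 i = J1 *m A i - A i *m J1.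
Proof. by case: (pq_derivation_inner (dJ1 i) (dJ2 i) (dJ12 i) (dJ21 i)). Qed.
Let A2 i : P2 i = J2 *m A i - A i *m J2.
Proof. by case: (pq_derivation_inner (dJ1 i) (dJ2 i) (dJ12 i) (dJ21 i)). Qed.
Let A3 i : P3 i = J3 *m A i - A i *m J3.
Proof. by case: (pq_derivation_inner (dJ1 i) (dJ2 i) (dJ12 i) (dJ21 i)). Qed.

Let T_anti X Y : torsion A X *m Y = - (torsion A Y *m X).
Proof. by rewrite !torsionE opprB. Qed.
Let T1 X Y : torsion A (J1 *m X) *m J1 *m Y - J1 *m torsion A (J1 *m X) *m Y
    - J1 *m torsion A X *m J1 *m Y + torsion A X *m Y = 0.
Proof. by rewrite -(torsion_nijenhuis (pq11 J) A1 N1 X Y) scale1r. Qed.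
Let T2 X Y : torsion A (J2 *m X) *m J2 *m Y - J2 *m torsion A (J2 *m X) *m Y
    - J2 *m torsion A X *m J2 *m Y + torsion A X *m Y = 0.
Proof. by rewrite -(torsion_nijenhuis (pq22 J) A2 N2 X Y) scale1r. Qed.
Let T3 X Y : torsion A (J3 *m X) *m J3 *m Y - J3 *m torsion A (J3 *m X) *m Y
    - J3 *m torsion A X *m J3 *m Y - torsion A X *m Y = 0.
Proof.
rewrite -(torsion_nijenhuis (e := -1) _ A3 N3 X Y); first by rewrite scaleN1r.
by rewrite (pq33 J) raddfN.
Qed.

Lemma obata_torsion_free i j : obata i *m delta_mx j 0 = obata j *m delta_mx i 0 :> 'cV[R]_n.
Proof.
have tE : torsion A (delta_mx i 0) *m delta_mx j 0 =
    A i *m delta_mx j 0 - A j *m delta_mx i 0 :> 'cV[R]_n.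
  by rewrite torsionE (along_delta A i) (along_delta A j).
have E a b : obata a *m delta_mx b 0 = A a *m delta_mx b 0
    + torsion_correction (torsion A) (delta_mx a 0) *m delta_mx b 0 :> 'cV[R]_n.
  exact: mulmxDl.
have key (a b c d s : 'cV[R]_n) : c - d = - s -> s = a - b -> a + c = b + d.
  by move=> h1 h2; rewrite h2 in h1; apply: (eq_from_sub h1); mx_linear.
apply: etrans (E i j) (etrans _ (esym (E j i))).
exact: key (torsion_correction_antisym T_anti T1 T2 T3 (delta_mx i 0) (delta_mx j 0)) tE.
Qed.

Lemma obata_parallel1 i : P1 i = J1 *m obata i - obata i *m J1.
Proof.
rewrite /obata mulmxDr mulmxDl (torsion_correction_comm1 T1) A1 -/A; mx_linear.
Qed.
Lemma obata_parallel2 i : P2 i = J2 *m obata i - obata i *m J2.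
Proof.
rewrite /obata mulmxDr mulmxDl torsion_correction_comm2 A2 -/A; mx_linear.
Qed.
End Obata.
End ParaQuaternions.

(** * Self-duality *)

Section Hodge.
Context {R : realType}.
Implicit Types (w g X : 'M[R]_4) (o : R).

Notation i0 := (@Ordinal 4 0 isT).
Notation i1 := (@Ordinal 4 1 isT).
Notation i2 := (@Ordinal 4 2 isT).
Notation i3 := (@Ordinal 4 3 isT).

Lemma sum4 (V : nmodType) (F : 'I_4 -> V) :
  \sum_i F i = F i0 + F i1 + F i2 + F i3.
Proof.
rewrite !big_ord_recl big_ord0 addr0 !addrA.
by congr (F _ + F _ + F _ + F _); apply: val_inj.
Qed.

Lemma forall_I4 (P : 'I_4 -> Prop) : P i0 -> P i1 -> P i2 -> P i3 -> forall i, P i.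
Proof.
by move=> p0 p1 p2 p3 [[|[|[|[|//]]]] h];
  rewrite (bool_irrelevance h isT).
Qed.

(** Entries are indexed by natural numbers, so that at concrete indices the expression reduces by
    computation. *)
Definition laplace4 (f : nat -> nat -> R) : R :=
  f 0 0 * (f 1 1 * (f 2 2 * f 3 3 - f 2 3 * f 3 2)
             - f 1 2 * (f 2 1 * f 3 3 - f 2 3 * f 3 1)
             + f 1 3 * (f 2 1 * f 3 2 - f 2 2 * f 3 1))
  - f 0 1 * (f 1 0 * (f 2 2 * f 3 3 - f 2 3 * f 3 2)
             - f 1 2 * (f 2 0 * f 3 3 - f 2 3 * f 3 0)
             + f 1 3 * (f 2 0 * f 3 2 - f 2 2 * f 3 0))
  + f 0 2 * (f 1 0 * (f 2 1 * f 3 3 - f 2 3 * f 3 1)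
             - f 1 1 * (f 2 0 * f 3 3 - f 2 3 * f 3 0)
             + f 1 3 * (f 2 0 * f 3 1 - f 2 1 * f 3 0))
  - f 0 3 * (f 1 0 * (f 2 1 * f 3 2 - f 2 2 * f 3 1)
             - f 1 1 * (f 2 0 * f 3 2 - f 2 2 * f 3 0)
             + f 1 2 * (f 2 0 * f 3 1 - f 2 1 * f 3 0)).

Lemma det_laplace4 (f : nat -> nat -> R) : \det (\matrix_(i < 4, j < 4) f i j) = laplace4 f.
Proof.
rewrite (expand_det_row _ (ord0 : 'I_4)) !big_ord_recl !big_ord0 /cofactor.
rewrite !(expand_det_row _ (ord0 : 'I_3)) !big_ord_recl !big_ord0 /cofactor.
rewrite !(expand_det_row _ (ord0 : 'I_2)) !big_ord_recl !big_ord0 /cofactor !det_mx11.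
rewrite !mxE /= /bump /= /laplace4.
by ring.
Qed.

Lemma levi_civitaE (a b c d : 'I_4) : levi_civita a b c d =
  laplace4 (fun r s => (nth (val a) [:: val a; val b; val c; val d] r == s)%:R) :> R.
Proof.
rewrite /levi_civita -det_laplace4; congr (\det _); apply/matrixP => i j.
rewrite !mxE (tnth_nth a) -(inj_eq val_inj) /= -(nth_map a (val a)) ?size_tuple //.
Qed.

(** The metric-free part of [hodge], in which the metric only raises indices and contributes a
    scalar factor; identities for [dual] are polynomial in the entries. *)
Definition dual w : 'M[R]_4 :=
  \matrix_(a, b) (2^-1 * \sum_c \sum_d levi_civita c d a b * w c d).

Lemma antisym_diag n (w : 'M[R]_n) : w^T = - w -> forall a, w a a = 0.
Proof.
move=> hw a; have : w a a = - w a a by rewrite -mxE_opp -hw mxE.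
by move=> /eqP; rewrite -addr_eq0 -mulr2n mulrn_eq0 => /eqP.
Qed.

Lemma dualE w : w^T = - w -> dual w = \matrix_(a, b)
  nth 0 (nth [::] [:: [:: 0; w i2 i3; - w i1 i3; w i1 i2];
    [:: - w i2 i3; 0; w i0 i3; - w i0 i2];
    [:: w i1 i3; - w i0 i3; 0; w i0 i1];
    [:: - w i1 i2; w i0 i2; - w i0 i1; 0]] a) b.
Proof.
move=> hw; have sw a b : w b a = - w a b by rewrite -mxE_opp -hw mxE.
have dw := antisym_diag hw.
apply/matrixP => a b; rewrite !mxE !sum4 !levi_civitaE /laplace4.
rewrite !dw (sw i0 i1) (sw i0 i2) (sw i0 i3) (sw i1 i2) (sw i1 i3) (sw i2 i3).
by elim/forall_I4: b; elim/forall_I4: a => /=; field.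
Qed.

(* The polarization of [w *m dual w = - Pf w *: 1]. *)
Lemma dual_polarized w w' : w^T = - w -> w'^T = - w' ->
  w *m dual w' + w' *m dual w = (2^-1 * \tr (w *m dual w'))%:M.
Proof.
move=> hw hw'; rewrite !dualE //.
have sw (u : 'M[R]_4) : u^T = - u -> forall a b, u b a = - u a b.
  by move=> hu a b; rewrite -mxE_opp -hu mxE.
apply/matrixP => a b; rewrite /mxtrace !mxE !sum4 !mxE !sum4 !mxE.
have dw := antisym_diag hw; have dw' := antisym_diag hw'.
have s := sw _ hw; have s' := sw _ hw'.
elim/forall_I4: b; elim/forall_I4: a => /=; rewrite ?dw ?dw' /=.
all: rewrite ?dw ?dw' ?(s i0 i1, s i0 i2, s i0 i3, s i1 i2, s i1 i3, s i2 i3).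
all: rewrite ?(s' i0 i1, s' i0 i2, s' i0 i3, s' i1 i2, s' i1 i3, s' i2 i3).
all: by field.
Qed.

Lemma hodge_dual g o w : hodge g o w =
  (o * Num.sqrt `|\det g|) *: dual (invmx g *m w *m (invmx g)^T).
Proof.
apply/matrixP => a b; rewrite !mxE [RHS]mulrCA; congr (_ * _).
rewrite mulr_sumr; apply: eq_bigr => c _; rewrite mulr_sumr; apply: eq_bigr => d _.
by rewrite !mulrA.
Qed.

(** Compatibility in linear form: because of the signs of the squares, the conditions on g(J_a X,
    J_a Y) all become skewness of [g *m J_a]. *)
Record neutral_compatible g (J1 J2 J3 : 'M[R]_4) : Prop := NeutralCompatible {
  nc_sym : g^T = g;
  nc_unit : g \in unitmx;
  nc_pq : paraquaternionic J1 J2 J3;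
  nc_skew1 : J1^T *m g = - (g *m J1);
  nc_skew2 : J2^T *m g = - (g *m J2);
  nc_skew3 : J3^T *m g = - (g *m J3) }.

Section SelfDual.
Variables (g J1 J2 J3 : 'M[R]_4) (o : R).
Hypothesis hg : neutral_compatible g J1 J2 J3.
Hypotheses (sd1 : self_dual g o (g *m J1)) (sd2 : self_dual g o (g *m J2))
  (sd3 : self_dual g o (g *m J3)).
Let J := nc_pq hg.

(* Polarize at the self-dual form [g J0] and at [g X]: the right-hand side of
   [dual_polarized] is then a multiple of [tr (J0 X) = 0]. *)
Lemma hodge_conj J0 X : self_dual g o (g *m J0) -> J0^T *m g = - (g *m J0) ->
  (g *m X)^T = - (g *m X) -> \tr (J0 *m X) = 0 ->
  J0 *m (invmx g *m hodge g o (g *m X)) = - (X *m J0).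
Proof.
move=> sd sk hX tr0.
have gK : invmx g *m g = 1%:M by rewrite mulVmx ?(nc_unit hg).
have Kg : g *m invmx g = 1%:M by rewrite mulmxV ?(nc_unit hg).
have hT : (invmx g)^T = invmx g by rewrite trmx_inv (nc_sym hg).
(* Raising both indices of the form [g *m Y]. *)
have low Y : invmx g *m (g *m Y) *m (invmx g)^T = Y *m invmx g.
  by rewrite mulmxA gK mul1mx hT.
have skew Y : (g *m Y)^T = - (g *m Y) -> (Y *m invmx g)^T = - (Y *m invmx g).
  rewrite trmx_mul (nc_sym hg) => hY.
  by rewrite trmx_mul hT -[Y^T]mulmx1 -Kg mulmxA hY mulNmx !mulmxN !mulmxA gK mul1mx.
move: sd; rewrite /self_dual !hodge_dual !low; set k := o * _ => sd.
have skJ : (g *m J0)^T = - (g *m J0) by rewrite trmx_mul (nc_sym hg).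
have := dual_polarized (skew _ hX) (skew _ skJ).
move=> /(congr1 ( *:%R k)).
rewrite scalerDr !scalemxAr sd scale_scalar_mx mulrCA -linearZ /= scalemxAr sd.
rewrite -(mulmxA X) (mulmxA (invmx g) g) gK mul1mx.
rewrite mxtrace_mulC tr0 mulr0 -scalemxAr -mulmxA => /eqP.
rewrite scalar_mx0 || rewrite raddf0.
by rewrite addrC addr_eq0 => /eqP <-; rewrite -!scalemxAr.
Qed.

(** The relations of [hodge_conj] are overdetermined. They give [D] as [- J1 X J1], as [- J2 X J2]
    and as [J3 X J3]; writing [J3] as [J1 J2] on the left and as [- J2 J1] on the right turns the
    last into [J1 D J1], which is [- X]. *)
Lemma orthogonal_selfdual X : (g *m X)^T = - (g *m X) ->
  \tr (J1 *m X) = 0 -> \tr (J2 *m X) = 0 -> \tr (J3 *m X) = 0 ->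
  [/\ J1 *m X = X *m J1, J2 *m X = X *m J2 & hodge g o (g *m X) = - (g *m X)].
Proof.
move=> hX t1 t2 t3.
have e1 := hodge_conj sd1 (nc_skew1 hg) hX t1.
have e2 := hodge_conj sd2 (nc_skew2 hg) hX t2.
have e3 := hodge_conj sd3 (nc_skew3 hg) hX t3.
set D := invmx g *m _ in e1 e2 e3.
have d1 : D = - (J1 *m X *m J1).
  by rewrite -mulmxA -mulmxN -e1 mulmxA (pq11 J) mul1mx.
have d2 : D = - (J2 *m X *m J2).
  by rewrite -mulmxA -mulmxN -e2 mulmxA (pq22 J) mul1mx.
have d3 : D = J3 *m X *m J3.
  by rewrite -mulmxA -[X *m J3]opprK -e3 mulmxN mulmxA (pq33 J) mulNmx mul1mx opprK.
have dX : D = - X.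
  rewrite d3 -{1}(pq12 J) -[J3]opprK -(pq21 J) mulmxN !mulmxA.
  rewrite -(mulmxA J1) -(mulmxA J1) -[_ *m _ *m J2]opprK -d2 d1.
  by rewrite !(mulmxN, mulNmx) opprK !mulmxA (pq11 J) mul1mx -mulmxA (pq11 J) mulmx1.
have cJ J0 : J0 *m D = - (X *m J0) -> J0 *m X = X *m J0.
  by rewrite dX mulmxN => /oppr_inj.
split; [exact: cJ e1|exact: cJ e2|].
by rewrite -mulmxN -dX /D mulmxA mulmxV ?mul1mx ?(nc_unit hg).
Qed.

(* Two compatible metrics differ by a scalar: [(k - c) J1], with [k] their
   quotient and [c] a quarter of its trace, is orthogonal to the self-dual
   forms, hence commutes with [J2], but it also anticommutes with [J2]. *)
Lemma compatible_proportional H : H^T = H ->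
  J1^T *m H = - (H *m J1) -> J2^T *m H = - (H *m J2) ->
  H = (4%:R^-1 * \tr (invmx g *m H)) *: g.
Proof.
move=> HS h1 h2; set k := invmx g *m H; set c := _ * _.
have gk : g *m k = H by rewrite mulmxA mulmxV ?mul1mx ?(nc_unit hg).
have trk : \tr k = c * 4 by rewrite /c; field.
clearbody k c.
have comm J0 : J0^T *m g = - (g *m J0) -> J0^T *m H = - (H *m J0) -> J0 *m k = k *m J0.
  move=> sg sH; have e : g *m (J0 *m k) = g *m (k *m J0).
    by rewrite (mulmxA g J0) (mulmxA g k) gk -[LHS]opprK -mulNmx -sg -mulmxA gk sH opprK.
  by rewrite -[LHS]mul1mx -(mulVmx (nc_unit hg)) -mulmxA e mulmxA mulVmx ?mul1mx ?(nc_unit hg).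
have k1 := comm _ (nc_skew1 hg) h1; have k2 := comm _ (nc_skew2 hg) h2.
have [t1 t2 t3] := pq_trace_comm J k1 k2.
pose X := (k - c%:M) *m J1.
have gX : g *m X = H *m J1 - c *: (g *m J1).
  by rewrite /X mulmxA mulmxBr gk mul_mx_scalar mulmxBl scalemxAl.
have X2 : J2 *m X = - (X *m J2).
  have kc2 : J2 *m (k - c%:M) = (k - c%:M) *m J2.
    by rewrite mulmxBr mulmxBl k2 scalar_mxC.
  by rewrite /X mulmxA kc2 -!mulmxA (pq21 J) (pq12 J) mulmxN.
have comm1 : [/\ \tr J1 = 0, \tr J2 = 0 & \tr J3 = 0].
  have := pq_trace_comm J (K := 1%:M); rewrite !mulmx1 !mul1mx; exact.
have [u1 u2 u3] := comm1.
have trX J0 : \tr (J0 *m X) = \tr (J1 *m J0 *m k) - c * \tr (J1 *m J0).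
  rewrite /X mulmxA mxtrace_mulC !mulmxA mulmxBr mul_mx_scalar raddfB /=.
  by rewrite mxtraceZ.
have x1 : \tr (J1 *m X) = 0.
  by rewrite trX (pq11 J) mul1mx mxtrace1 trk subrr.
have x2 : \tr (J2 *m X) = 0 by rewrite trX (pq12 J) t3 u3 mulr0 subr0.
have x3 : \tr (J3 *m X) = 0 by rewrite trX (pq13 J) t2 u2 mulr0 subr0.
have gXT : (g *m X)^T = - (g *m X).
  rewrite gX linearB linearZ /= !trmx_mul HS (nc_sym hg) h1 (nc_skew1 hg).
  by mx_linear.
have [_ X2' _] := orthogonal_selfdual gXT x1 x2 x3.
have X0 : X = 0.
  have J2X : J2 *m X = 0.
    by apply: (eq_from_sub (congr1 ( *:%R 2^-1) (congr2 +%R X2 X2'))); mx_linear.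
  by rewrite -[X]mul1mx -(pq22 J) -mulmxA J2X mulmx0.
have kc : k = c%:M.
  apply/eqP; rewrite -subr_eq0; apply/eqP.
  by rewrite -[LHS]mulmx1 -(pq11 J) mulmxA -/X X0 mul0mx.
by rewrite -gk kc mul_mx_scalar.
Qed.
End SelfDual.

End Hodge.

(** * Calculus of matrix-valued maps *)

Section Schwarz.
Context {R : realType} {U : normedModType R}.
Implicit Types (f : U -> R) (p v a b : U).

Lemma derivable_shift f p v c : derivable f (p + c) v -> derivable (fun q => f (q + c)) p v.
Proof.
rewrite /derivable; set F := fun h => _; set G := fun h => _.
suff -> : F = G by []; by apply/funext => s; rewrite /F /G /= addrA.
Qed.

Lemma derive_shift f p v c : 'D_v (fun q => f (q + c)) p = 'D_v f (p + c).
Proof.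
rewrite /derive; set F := fun h => _; set G := fun h => _.
suff -> : F = G by []; by apply/funext => s; rewrite /F /G /= addrA.
Qed.

Lemma is_derive_line f p v (s : R) : derivable f (s *: v + p) v ->
  is_derive s 1 (fun t : R => f (t *: v + p)) ('D_v f (s *: v + p)).
Proof.
move=> h; have E : (fun t : R => t^-1 *: (f ((t *: (1 : R) + s) *: v + p) - f (s *: v + p)))
   = (fun t => t^-1 *: (f (t *: v + (s *: v + p)) - f (s *: v + p))).
  by apply/funext => t; rewrite scalerDl [t *: 1]mulr1 addrA.
apply: DeriveDef; first by rewrite /derivable /= E.
by rewrite /derive /= E.
Qed.

Lemma line_MVT f p v (h : R) : 0 < h ->
  (forall s, 0 <= s <= h -> derivable f (s *: v + p) v) ->
  exists2 s, 0 <= s <= h & f (h *: v + p) - f p = h * 'D_v f (s *: v + p).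
Proof.
move=> h0 df.
have [||s] := @MVT R (fun t => f (t *: v + p)) (fun t => 'D_v f (t *: v + p)) 0 h h0.
- by move=> s /[!in_itv] /= /andP[s0 sh]; apply/is_derive_line/df; rewrite !ltW.
- apply: derivable_within_continuous => s /[!in_itv] /= sh.
  by have [] := is_derive_line (df s sh).
rewrite in_itv /= => /andP[s0 sh]; rewrite scale0r add0r subr0 => e.
by exists s; rewrite ?ltW // e mulrC.
Qed.

(** The mean value theorem is applied along [a] to the difference [phi] of [f] in direction [b],
    then along [b] to the derivative of [f] in direction [a]. *)
Lemma double_difference f p a b (h : R) : 0 < h ->
  (forall s t, 0 <= s <= h -> 0 <= t <= h -> derivable f (s *: a + t *: b + p) a) ->
  (forall s t, 0 <= s <= h -> 0 <= t <= h -> derivable ('D_a f) (s *: a + t *: b + p) b) ->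
  exists s t, [/\ 0 <= s <= h, 0 <= t <= h &
    f (h *: a + h *: b + p) - f (h *: a + p) - f (h *: b + p) + f p =
    h * h * 'D_b ('D_a f) (s *: a + t *: b + p)].
Proof.
move=> h0 da db; have hh : 0 <= h <= h by apply/andP; split; rewrite ?lexx ?ltW.
have h00 : 0 <= (0 : R) <= h by apply/andP; split; rewrite ?lexx ?ltW.
pose phi q := f (q + h *: b) - f q.
have d1 s : 0 <= s <= h -> derivable (fun q => f (q + h *: b)) (s *: a + p) a.
  by move=> sh; apply: derivable_shift; rewrite addrAC; apply: da.
have d2 s : 0 <= s <= h -> derivable f (s *: a + p) a.
  by move=> sh; have := da s 0 sh h00; rewrite scale0r addr0.
have [s sh e] := @line_MVT phi p a h h0 (fun s sh => derivableB (d1 s sh) (d2 s sh)).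
have [t th e'] := @line_MVT ('D_a f) (s *: a + p) b h h0
  (fun t th => eq_ind _ (fun z => derivable ('D_a f) z b) (db s t sh th) _
     (etrans (congr1 (+%R^~ p) (addrC _ _)) (esym (addrA _ _ _)))).
exists s, t; split; [exact: sh|exact: th|].
have e1 : f (h *: a + h *: b + p) - f (h *: a + p) - f (h *: b + p) + f p =
    phi (h *: a + p) - phi p.
  by rewrite /phi [p + _]addrC [h *: a + p + _]addrAC opprB addrA [RHS]addrAC.
have e2 : 'D_a phi (s *: a + p) = 'D_a f (h *: b + (s *: a + p)) - 'D_a f (s *: a + p).
  by rewrite (deriveB (d1 s sh) (d2 s sh)) derive_shift [h *: b + _]addrC.
have -> : s *: a + t *: b + p = t *: b + (s *: a + p).
  by rewrite addrA [t *: b + _]addrC.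
by rewrite e1 e e2 e'; exact: mulrA.
Qed.

(** The double difference is symmetric in [a] and [b], so the two mixed derivatives agree at
    suitable points arbitrarily close to [x]; continuity carries this to [x]. *)
Lemma schwarz (V : set U) f a b x : open V -> V x ->
  (forall y, V y -> derivable f y a /\ derivable f y b) ->
  (forall y, V y -> derivable ('D_a f) y b /\ derivable ('D_b f) y a) ->
  {for x, continuous ('D_b ('D_a f))} -> {for x, continuous ('D_a ('D_b f))} ->
  'D_b ('D_a f) x = 'D_a ('D_b f) x.
Proof.
move=> oV Vx d1 d2 cb ca.
apply/eqP; rewrite -subr_eq0 -normr_le0; apply/ler_addgt0Pl => e e0; rewrite addr0.
have e20 : 0 < e / 2 by rewrite divr_gt0.
have /cvgrPdist_lt/(_ _ e20) nb := cb; have /cvgrPdist_lt/(_ _ e20) na := ca.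
have nV : nbhs x V by exact: open_nbhs_nbhs.
have /nbhs_ballP[r /= r0 hr] : nbhs x (V `&`
    ([set y | `|'D_b ('D_a f) x - 'D_b ('D_a f) y| < e / 2] `&`
     [set y | `|'D_a ('D_b f) x - 'D_a ('D_b f) y| < e / 2])).
  exact: filterI nV (filterI nb na).
(* The added 1 keeps [N] positive even if both directions vanish. With [h * N = r / 2], the whole
   parallelogram stays in the ball of radius [r]. *)
pose N := `|a| + `|b| + 1; have N0 : 0 < N by apply: ltr_wpDl; [exact: addr_ge0|exact: ltr01].
pose h := r / (2 * N); have h0 : 0 < h by rewrite divr_gt0 // mulr_gt0.
have inb s t (c d : U) : 0 <= s <= h -> 0 <= t <= h -> `|c| + `|d| + 1 = N ->
    ball x r (s *: c + t *: d + x).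
  move=> /andP[s0 sh] /andP[t0 th] hN.
  rewrite -ball_normE /= opprD addrCA subrr addr0 normrN.
  apply: le_lt_trans (ler_normD _ _) _; rewrite !normrZ !ger0_norm //.
  have : s * `|c| + t * `|d| <= h * N.
    rewrite -hN !mulrDr -[leLHS]addr0; apply: lerD; last by rewrite mulr1 ltW.
    by apply: lerD; apply: ler_wpM2r.
  move=> /le_lt_trans; apply; rewrite /h invfM mulrA divfK ?gt_eqF //.
  by rewrite ltr_pdivrMr // ltr_pMr // ltr1n.
have Nab : `|a| + `|b| + 1 = N by [].
have Nba : `|b| + `|a| + 1 = N by rewrite /N [`|b| + _]addrC.
have [s [t [hs ht e1]]] := @double_difference f x a b h h0
  (fun s t hs ht => (d1 _ (hr _ (inb s t a b hs ht Nab)).1).1)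
  (fun s t hs ht => (d2 _ (hr _ (inb s t a b hs ht Nab)).1).1).
have [s' [t' [hs' ht' e2]]] := @double_difference f x b a h h0
  (fun s t hs ht => (d1 _ (hr _ (inb s t b a hs ht Nba)).1).2)
  (fun s t hs ht => (d2 _ (hr _ (inb s t b a hs ht Nba)).1).2).
have [_ [/= h1 _]] := hr _ (inb s t a b hs ht Nab).
have [_ [_ /= h2]] := hr _ (inb s' t' b a hs' ht' Nba).
have e3 : 'D_b ('D_a f) (s *: a + t *: b + x) = 'D_a ('D_b f) (s' *: b + t' *: a + x).
  apply: (mulfI (x := h * h)); first by rewrite mulf_neq0 ?gt_eqF.
  apply: etrans (esym e1) (etrans _ e2); rewrite (addrC (h *: b) (h *: a)).
  exact: (congr1 (fun z => z + f x) (addrAC _ (- f _) (- f _))).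
rewrite e3 in h1; move: h1 h2.
move: ('D_a ('D_b f) (_ + x)) ('D_b ('D_a f) x) ('D_a ('D_b f) x) => z u v h1 h2.
have -> : u - v = (u - z) - (v - z) by ring.
apply: le_trans (ler_normB _ _) _; rewrite [e]splitr; exact: ltW (ltrD h1 h2).
Qed.

End Schwarz.

(** * Differentiation rules for products, determinants and inverses of matrices *)

Section MatrixDerivatives.
Context {R : realType} {U : normedModType R}.
Variables (x v : U).

Lemma is_derive_mxP m n (F : U -> 'M[R]_(m, n)) dF :
  is_derive x v F dF <-> forall i j, is_derive x v (fun y => F y i j) (dF i j).
Proof.
split=> [[dx <-] i j|h].
  apply: DeriveDef; first by move/derivable_mxP: dx; exact.
  by rewrite derive_mx // mxE.
have dx : derivable F x v by apply/derivable_mxP => i j; have [] := h i j.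
apply: DeriveDef => //; rewrite derive_mx //; apply/matrixP => i j.
by rewrite mxE; have [] := h i j.
Qed.

Lemma is_derive_mulmx m n p (F : U -> 'M[R]_(m, n)) (G : U -> 'M[R]_(n, p)) dF dG :
  is_derive x v F dF -> is_derive x v G dG ->
  is_derive x v (fun y => F y *m G y) (dF *m G x + F x *m dG).
Proof.
move=> /is_derive_mxP hF /is_derive_mxP hG; apply/is_derive_mxP => i j.
have -> : (fun y => (F y *m G y) i j) = \sum_k ((fun y => F y i k) * (fun y => G y k j)).
  by apply/funext => y; rewrite mxE fct_sumE.
apply: (is_derive_eq (is_derive_sum (fun k => is_deriveM (hF i k) (hG k j)))).
rewrite !mxE -big_split; apply: eq_bigr => k _ /=.
by rewrite addrC /GRing.scale /= [dF i k * _]mulrC.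
Qed.

Lemma is_derive_trmx m n (F : U -> 'M[R]_(m, n)) dF :
  is_derive x v F dF -> is_derive x v (fun y => (F y)^T) dF^T.
Proof.
move=> /is_derive_mxP hF; apply/is_derive_mxP => i j; rewrite mxE.
by have -> : (fun y => (F y)^T i j) = (fun y => F y j i) by apply/funext => y; rewrite mxE.
Qed.

Lemma is_derive_scalemx m n (f : U -> R) (F : U -> 'M[R]_(m, n)) df dF :
  is_derive x v f df -> is_derive x v F dF ->
  is_derive x v (fun y => f y *: F y) (df *: F x + f x *: dF).
Proof.
move=> hf /is_derive_mxP hF; apply/is_derive_mxP => i j; rewrite !mxE.
have -> : (fun y => (f y *: F y) i j) = f * (fun y => F y i j).
  by apply/funext => y; rewrite mxE.
by apply: is_derive_eq; rewrite addrC [df * _]mulrC.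
Qed.

Lemma derivable_mulfun (f g : U -> R) :
  derivable f x v -> derivable g x v -> derivable (fun y => f y * g y) x v.
Proof. exact: derivableM. Qed.

Lemma derivable_prod (I : Type) (r : seq I) (f : I -> U -> R) :
  (forall i, derivable (f i) x v) -> derivable (fun y => \prod_(i <- r) f i y) x v.
Proof.
move=> h; elim: r => [|i r IH].
  have -> : (fun y => \prod_(i <- [::]) f i y) = cst 1.
    by apply/funext => y; rewrite big_nil.
  exact: derivable_cst.
have -> : (fun y => \prod_(j <- i :: r) f j y) = f i * (fun y => \prod_(j <- r) f j y).
  by apply/funext => y; rewrite big_cons.
exact: (derivableM (h i) IH).
Qed.

Lemma derivable_bigsum (I : Type) (r : seq I) (f : I -> U -> R) :
  (forall i, derivable (f i) x v) -> derivable (fun y => \sum_(i <- r) f i y) x v.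
Proof.
move=> h; elim: r => [|i r IH].
  have -> : (fun y => \sum_(i <- [::]) f i y) = cst 0.
    by apply/funext => y; rewrite big_nil.
  exact: derivable_cst.
have -> : (fun y => \sum_(j <- i :: r) f j y) = f i + (fun y => \sum_(j <- r) f j y).
  by apply/funext => y; rewrite big_cons.
exact: (derivableD (h i) IH).
Qed.

Lemma derivable_det n (F : U -> 'M[R]_n) :
  (forall i j, derivable (fun y => F y i j) x v) -> derivable (fun y => \det (F y)) x v.
Proof.
move=> h; apply: derivable_bigsum => s.
apply: derivable_mulfun.
  exact: derivable_cst.
exact: derivable_prod.
Qed.

(** By Cramer's rule. Invertibility is asked near [x] because [invmx] returns a singular matrix
    unchanged, where the rule fails. *)
Lemma derivable_invmx n (F : U -> 'M[R]_n) :
  (\forall y \near x, F y \in unitmx) -> derivable F x v ->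
  derivable (fun y => invmx (F y)) x v.
Proof.
move=> uF /derivable_mxP hF; apply/derivable_mxP => i j.
apply: (@near_eq_derivable _ _ _ (fun y => (\det (F y))^-1 * cofactor (F y) j i)).
  by near=> y; rewrite /invmx (near uF y) // !mxE.
apply: derivable_mulfun.
  apply: derivableV; last exact: derivable_det.
  by have := nbhs_singleton uF; rewrite unitmxE unitfE.
apply: derivable_mulfun.
  exact: derivable_cst.
apply: derivable_det => k l.
have -> : (fun y => row' j (col' i (F y)) k l) = (fun y => F y (lift j k) (lift i l)).
  by apply/funext => y; rewrite !mxE.
exact: hF.
Unshelve. all: by end_near. Qed.

Lemma derivable_mxtrace n (F : U -> 'M[R]_n) :
  derivable F x v -> derivable (fun y => \tr (F y)) x v.
Proof. by move=> /derivable_mxP h; apply: derivable_bigsum. Qed.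

End MatrixDerivatives.

Section SmoothMaps.
Context {R : realType}.
Implicit Types (V W : set (vec4 R)).

Lemma Ck_subset k V W f : W `<=` V -> Ck k V f -> Ck k W f.
Proof.
elim: k f => [|k IH] f sub [c d]; split=> //; try by move=> x /sub; apply: c.
by move=> i; have [d1 d2] := d i; split=> [x /sub|]; [exact: d1|exact: IH].
Qed.

Lemma smooth_mx_subset m n V W (A : vec4 R -> 'M[R]_(m, n)) :
  W `<=` V -> smooth_mx V A -> smooth_mx W A.
Proof. by move=> sub h i j k; apply: (Ck_subset sub); apply: h. Qed.

Lemma smooth_mx_cst m n V (A : 'M[R]_(m, n)) : smooth_mx V (fun=> A).
Proof.
move=> i j k; move: (A i j); elim: k => [|k IH] c; split=> //=.
- by move=> x _; exact: cst_continuous.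
- by move=> x _; exact: cst_continuous.
- move=> l; split=> [x _|]; first exact: derivable_cst.
  have -> : partial l (fun=> c) = (fun=> 0 : R); last exact: IH.
  by apply/funext => x; rewrite /partial derive_cst.
Qed.

Section Derivatives.
Variables (m n : nat) (V : set (vec4 R)) (A : vec4 R -> 'M[R]_(m, n)).
Hypothesis hA : smooth_mx V A.

Lemma smooth_derivable i x : V x -> derivable A x (e_ i).
Proof.
move=> Vx; apply/derivable_mxP => a b.
by have [_ /(_ i)[d _]] := hA a b 1; apply: d.
Qed.

Lemma smooth_derive_entry i x a b : V x -> 'D_(e_ i) A x a b = partial i (fun y => A y a b) x.
Proof. by move=> Vx; rewrite derive_mx ?mxE //; exact: smooth_derivable. Qed.

Lemma smooth_is_derive i x : V x -> is_derive x (e_ i) A ('D_(e_ i) A x).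
Proof. by move=> Vx; apply: DeriveDef => //; exact: smooth_derivable. Qed.

Hypothesis oV : open V.

Lemma smooth_derivable2 i j x : V x -> derivable ('D_(e_ i) A) x (e_ j).
Proof.
move=> Vx; apply/derivable_mxP => a b.
apply: (@near_eq_derivable _ _ _ (partial i (fun y => A y a b))).
  near=> y; apply/esym/smooth_derive_entry; near: y; exact: open_nbhs_nbhs.
by have [_ /(_ i)[_ [_ /(_ j)[d _]]]] := hA a b 2; apply: d.
Unshelve. all: by end_near. Qed.

Lemma smooth_is_derive2 i j x : V x ->
  is_derive x (e_ j) ('D_(e_ i) A) ('D_(e_ j) ('D_(e_ i) A) x).
Proof. by move=> Vx; apply: DeriveDef => //; exact: smooth_derivable2. Qed.

Lemma smooth_schwarz i j x : V x ->
  'D_(e_ j) ('D_(e_ i) A) x = 'D_(e_ i) ('D_(e_ j) A) x.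
Proof.
move=> Vx.
apply/matrixP => a b.
have E k l : 'D_(e_ l) ('D_(e_ k) A) x a b = 'D_(e_ l) ('D_(e_ k) (fun y => A y a b)) x.
  rewrite (derive_mx (@smooth_derivable2 k l x Vx)) mxE.
  apply: near_eq_derive; near=> y.
  apply: smooth_derive_entry; near: y; exact: open_nbhs_nbhs.
apply: etrans (E i j) (etrans _ (esym (E j i))).
have [_ D] := hA a b 2.
have [[di [_ Di]] [dj [_ Dj]]] := (D i, D j).
have [dij [cij _]] := Di j; have [dji [cji _]] := Dj i.
apply: (schwarz oV Vx).
- by move=> y Vy; split; [apply: di|apply: dj].
- by move=> y Vy; split; [apply: dij|apply: dji].
- exact: cij.
- exact: cji.
Unshelve. all: by end_near. Qed.

End Derivatives.
End SmoothMaps.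

Arguments smooth_derivable {R m n V A} hA i {x}.
Arguments smooth_is_derive {R m n V A} hA i {x}.
Arguments smooth_derivable2 {R m n V A} hA oV i j {x}.
Arguments smooth_is_derive2 {R m n V A} hA oV i j {x}.
Arguments smooth_schwarz {R m n V A} hA oV i j {x}.

Section Nijenhuis.
Context {R : realType}.
Implicit Types (x X Y : vec4 R).

Lemma lie_bracketE (F G : vec4 R -> vec4 R) dF dG x :
  (forall l, is_derive x (e_ l) F (dF l)) -> (forall l, is_derive x (e_ l) G (dG l)) ->
  lie_bracket F G x = \sum_l (F x l 0 *: dG l - G x l 0 *: dF l).
Proof.
move=> hF hG; apply/matrixP => k j; rewrite ord1 /lie_bracket mxE summxE.
apply: eq_bigr => l _; rewrite !mxE /partial.
have /is_derive_mxP/(_ k 0)[_ ->] := hG l.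
by have /is_derive_mxP/(_ k 0)[_ ->] := hF l.
Qed.

(** On constant fields the brackets see only the derivatives of [J], so integrability becomes the
    pointwise algebraic condition from which the Obata connection is built. *)
Lemma nijenhuis_cst (J : vec4 R -> 'M[R]_4) X Y x :
  (forall l, derivable J x (e_ l)) ->
  let P l := 'D_(e_ l) J x in
  nijenhuis J (fun=> X) (fun=> Y) x =
    along P (J x *m X) *m Y - along P (J x *m Y) *m X
    + J x *m along P Y *m X - J x *m along P X *m Y.
Proof.
move=> dJ P.
have hJ (Z : vec4 R) l : is_derive x (e_ l) (fun y => J y *m Z) (P l *m Z).
  have := is_derive_mulmx (derivableP (dJ l)) (is_derive_cst Z x (e_ l)).
  by rewrite mulmx0 addr0.
have hc Z l : is_derive x (e_ l) (fun=> Z : vec4 R) 0 by exact: is_derive_cst.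
rewrite /nijenhuis (lie_bracketE (hJ X) (hJ Y)) (lie_bracketE (hJ X) (hc Y)).
rewrite (lie_bracketE (hc X) (hJ Y)) (lie_bracketE (hc X) (hc Y)).
have alongE Z W : along P Z *m W = \sum_l Z l 0 *: (P l *m W).
  by rewrite /along mulmx_suml; apply: eq_bigr => l _; rewrite scalemxAl.
rewrite -!mulmxA !alongE !sumrB.
have z1 Z : \sum_(l < 4) Z l 0 *: (0 : vec4 R) = 0.
  by rewrite big1 // => l _; rewrite scaler0.
by rewrite !z1 ?(subr0, sub0r, mulmx0, addr0, mulmxN, opprK).
Qed.
End Nijenhuis.

(** * Curvature of Weyl connections *)

Section KulkarniNomizu.
Context {R : realType}.
Implicit Types (K : 'M[R]_4) (i j k : 'I_4).
Variable g : 'M[R]_4.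
Hypotheses (gT : g^T = g) (gU : g \in unitmx).

(** The first index is raised, giving an endomorphism for each pair of directions. [K] may be
    non-symmetric: [i] and [j] always occupy its first slot. For symmetric [K] this is minus the
    usual product, in agreement with the sign of its Ricci contraction below. *)
Definition kulkarni_nomizu K i j : 'M[R]_4 :=
  delta_mx j 0 *m row i K - delta_mx i 0 *m row j K
  - invmx g *m (row i K)^T *m row j g + invmx g *m (row j K)^T *m row i g.

Lemma low_kulkarni_nomizu K i j a b : (g *m kulkarni_nomizu K i j) a b =
  g a j * K i b - g a i * K j b - K i a * g j b + K j a * g i b.
Proof.
have gV : g *m invmx g = 1%:M by rewrite mulmxV.
have r1 i' j' : (g *m (delta_mx i' 0 *m row j' K)) a b = g a i' * K j' b.
  by rewrite mulmxA -colE mxE big_ord1 !mxE.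
have r2 i' j' : (g *m (invmx g *m (row i' K)^T *m row j' g)) a b = K i' a * g j' b.
  by rewrite !mulmxA gV mul1mx mxE big_ord1 !mxE.
by rewrite /kulkarni_nomizu !mulmxDr !mulmxN !mxE_lin !r1 !r2.
Qed.

Definition metric_trace K : R := \tr (invmx g *m K^T).

Lemma ricci_kulkarni_nomizu K j k : \sum_i kulkarni_nomizu K i j i k =
  - (2 * K j k) - metric_trace K * g j k.
Proof.
have gV : g *m invmx g = 1%:M by rewrite mulmxV.
have E i : kulkarni_nomizu K i j i k = (i == j)%:R * K i k - K j k
    - (invmx g *m K^T) i i * g j k + (invmx g *m (row j K)^T) i 0 * g i k.
  rewrite /kulkarni_nomizu !mxE_lin.
  have r1 i' j' : (delta_mx i' 0 *m row j' K : 'M[R]_4) i k = (i == i')%:R * K j' k.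
    by rewrite mxE big_ord1 !mxE andbT.
  have r2 i' j' : (invmx g *m (row i' K)^T *m row j' g) i k = (invmx g *m (row i' K)^T) i 0 * g j' k.
    by rewrite mxE big_ord1 [row j' g _ _]mxE.
  rewrite !r1 !r2 eqxx mul1r; congr (_ - _ * _ + _).
  by rewrite tr_row colE mulmxA -colE mxE.
under eq_bigr => i _ do rewrite E.
rewrite big_split /= sumrB sumrB -mulr_suml -/(mxtrace _) -/(metric_trace K).
rewrite sumr_const card_ord (bigD1 j) //= eqxx mul1r big1; last first.
  by move=> i /negbTE ->; rewrite mul0r.
have -> : \sum_i (invmx g *m (row j K)^T) i 0 * g i k = K j k.
  transitivity ((g *m (invmx g *m (row j K)^T)) k 0).
    by rewrite mxE; apply: eq_bigr => i _; rewrite mulrC -{1}gT mxE.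
  by rewrite mulmxA gV mul1mx !mxE.
rewrite -mulr_natl; ring.
Qed.

End KulkarniNomizu.

(** * Algebra of a curvature that commutes with the structures *)

Section ObataCurvature.
Context {R : realType}.
Variables (g J1 J2 J3 : 'M[R]_4) (o : R).
Hypothesis hg : neutral_compatible g J1 J2 J3.
Let J := nc_pq hg.
Variable Q : 'I_4 -> 'I_4 -> 'M[R]_4.
Hypothesis QC : forall i j, Q j i = - Q i j.
Hypothesis Q1 : forall i j, J1 *m Q i j = Q i j *m J1.
Hypothesis Q2 : forall i j, J2 *m Q i j = Q i j *m J2.
Hypothesis bianchi : forall i j k l, Q i j l k + Q j k l i + Q k i l j = 0.

Definition ricci_mx : 'M[R]_4 := \matrix_(k, j) \sum_i Q i j i k.
Notation q := ricci_mx.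

(* By the Bianchi identity, the failure of [J0^T q] to be symmetric is
   [tr (J0 Q_jk)]. *)
Lemma ricci_mx_comm J0 : (forall i j, J0 *m Q i j = Q i j *m J0) ->
  (forall i j, \tr (J0 *m Q i j) = 0) -> J0^T *m q = q^T *m J0.
Proof.
move=> hJ0 tr0.
have E k j : (J0^T *m q) k j = \sum_i (J0 *m Q i j) i k.
  rewrite mxE; under eq_bigr => m _ do rewrite !mxE mulr_sumr.
  rewrite exchange_big; apply: eq_bigr => i _ /=; rewrite hJ0 mxE.
  by apply: eq_bigr => m _; rewrite mulrC.
rewrite -[RHS]trmxK trmx_mul trmxK; apply/matrixP => k j; rewrite [RHS]mxE !E.
apply/eqP; rewrite -subr_eq0 -sumrB; apply/eqP.
transitivity (- \tr (J0 *m Q j k)); last by rewrite tr0 oppr0.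
rewrite /mxtrace -sumrN; apply: eq_bigr => i _.
rewrite !mxE -sumrB -sumrN; apply: eq_bigr => m _.
have h := bianchi i j k m; rewrite (QC i k) mxE in h.
rewrite -mulrBr -mulrN; congr (_ * _); lra.
Qed.

Lemma ricci_mx_trace k j : q k j - q j k = \tr (Q k j).
Proof.
rewrite !mxE -sumrB; apply: eq_bigr => i _.
have := bianchi i j k i; rewrite (QC i k) (QC k j) !mxE; lra.
Qed.

Lemma curvature_trace0 i j :
  [/\ \tr (J1 *m Q i j) = 0, \tr (J2 *m Q i j) = 0 & \tr (J3 *m Q i j) = 0].
Proof. exact: (pq_trace_comm J). Qed.

(** Moving [q] through [J3^T], that is [J2^T *m J1^T], transposes it twice and yields
    [q *m J2 *m J1], which is [- q *m J3]; moving it through [J3^T] directly yields [q^T *m J3]. *)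
Lemma ricci_mx_skew : [/\ q^T = - q, J1^T *m q = - (q *m J1),
  J2^T *m q = - (q *m J2) & J3^T *m q = - (q *m J3)].
Proof.
have Q3 i j := pq_comm3 J (Q1 i j) (Q2 i j).
have e1 : J1^T *m q = q^T *m J1.
  by apply: ricci_mx_comm => // i j; have [] := curvature_trace0 i j.
have e2 : J2^T *m q = q^T *m J2.
  by apply: ricci_mx_comm => // i j; have [] := curvature_trace0 i j.
have e3 : J3^T *m q = q^T *m J3.
  by apply: ricci_mx_comm => // i j; have [] := curvature_trace0 i j.
have e2' : J2^T *m q^T = q *m J2.
  have J22 : J2^T *m J2^T = 1%:M by rewrite -trmx_mul (pq22 J) trmx1.
  have -> : q^T = J2^T *m (q *m J2) by rewrite mulmxA e2 -mulmxA (pq22 J) mulmx1.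
  by rewrite mulmxA J22 mul1mx.
have qT : q^T = - q.
  have e4 : q^T *m J3 = - q *m J3.
    rewrite -e3 -{1}(pq12 J) trmx_mul -mulmxA e1 mulmxA e2' -mulmxA (pq21 J).
    by rewrite mulmxN mulNmx.
  have := congr1 (fun M => M *m J3) e4; rewrite -!mulmxA (pq33 J) !mulmxN !mulmx1.
  exact: oppr_inj.
by rewrite e1 e2 e3 qT !mulNmx.
Qed.

Variable t : 'M[R]_4.
Hypothesis metricity : forall i j, (Q i j)^T *m g + g *m Q i j = - (t i j *: g).

(** The metric trace of [metricity] gives tr Q = - 2 t, while the contracted Bianchi identity and
    skewness of [q] give tr Q = 2 q. *)
Lemma ricci_mxE : q = - t.
Proof.
apply/matrixP => k j.
have h : \tr (invmx g *m ((Q k j)^T *m g + g *m Q k j)) = - (t k j * 4).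
  rewrite metricity mulmxN -scalemxAr mulVmx ?(nc_unit hg) //.
  by rewrite raddfN /= mxtraceZ mxtrace1.
rewrite mulmxDr raddfD /= mulmxA mxtrace_mulC !mulmxA mulmxV ?mulVmx ?(nc_unit hg) // in h.
rewrite !mul1mx mxtrace_tr -ricci_mx_trace in h.
have [qT _ _ _] := ricci_mx_skew.
have s : q j k = - q k j by rewrite -mxE_opp -qT [RHS]mxE.
rewrite s in h; rewrite mxE_opp; lra.
Qed.

(* The endomorphism W(d_c, d_d), see [weylE] below. *)
Definition weyl_mx c d : 'M[R]_4 :=
  Q c d + 2^-1 *: (t c d *: 1%:M) + 4%:R^-1 *: kulkarni_nomizu g t c d.

Lemma low_weyl_mx a b c d : (g *m weyl_mx c d) a b = (g *m Q c d) a b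
  + 2^-1 * (t c d * g a b)
  + 4%:R^-1 * (g a d * t c b - g a c * t d b - t c a * g d b + t d a * g c b).
Proof.
rewrite /weyl_mx !mulmxDr -!scalemxAr mulmx1 !mxE_lin.
by rewrite low_kulkarni_nomizu ?(nc_unit hg).
Qed.

(** The scalar term 1/2 t cancels the symmetric part of [g *m Q c d], and the Kulkarni-Nomizu term
    is already skew. *)
Lemma weyl_mx_antisym c d : (g *m weyl_mx c d)^T = - (g *m weyl_mx c d).
Proof.
apply/matrixP => a b; rewrite mxE mxE_opp !low_weyl_mx.
have gS i j : g j i = g i j by rewrite -{1}(nc_sym hg) mxE.
have m : (g *m Q c d) b a + (g *m Q c d) a b = - (t c d * g a b).
  have := congr1 (fun M : 'M[R]_4 => M a b) (metricity c d).
  by rewrite -{1}(nc_sym hg) -trmx_mul mxE_opp mxE_scale mxE_add mxE.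
have -> : (g *m Q c d) b a = - (t c d * g a b) - (g *m Q c d) a b by rewrite -m addrK.
rewrite (gS a b) (gS b c) (gS b d) (gS a c) (gS a d); by field.
Qed.

(** As [J0] is skew for both [g] and [t], the raised terms of the Kulkarni-Nomizu product contribute
    the opposite of the other two. *)
Lemma weyl_mx_trace0 J0 c d : J0^T *m g = - (g *m J0) -> J0^T *m t = - (t *m J0) ->
  t^T = - t -> \tr J0 = 0 -> \tr (J0 *m Q c d) = 0 -> \tr (J0 *m weyl_mx c d) = 0.
Proof.
move=> gJ tJ tT tr0 trQ.
have r1 i j : \tr (J0 *m (delta_mx i 0 *m row j t)) = (t *m J0) j i.
  by rewrite mulmxA mxtrace_mulC mulmxA -row_mul -colE /mxtrace big_ord1 2!mxE.
have r2 i j : \tr (J0 *m (invmx g *m (row i t)^T *m row j g)) = - (t *m J0) j i.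
  have gJg : g *m J0 *m invmx g = - J0^T.
    by rewrite -[g *m J0]opprK -gJ mulNmx -mulmxA mulmxV ?mulmx1 ?(nc_unit hg).
  rewrite !mulmxA mxtrace_mulC !mulmxA -!row_mul gJg tr_row tT -mxE_opp -tJ.
  by rewrite colE mulmxA -colE mulmxN mulNmx opprK /mxtrace big_ord1 2!mxE.
rewrite /weyl_mx /kulkarni_nomizu !mulmxDr -!scalemxAr !mulmxDr !mulmxN mulmx1.
rewrite !mxtraceD !mxtraceZ !mxtraceD !raddfN /=  ?mxtraceZ tr0 trQ !r1 !r2.
by field.
Qed.

Lemma weyl_mx_asd c d :
  self_dual g o (g *m J1) -> self_dual g o (g *m J2) -> self_dual g o (g *m J3) ->
  hodge g o (g *m weyl_mx c d) = - (g *m weyl_mx c d).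
Proof.
move=> sd1 sd2 sd3.
have [tT tJ1 tJ2 tJ3] := ricci_mx_skew; rewrite ricci_mxE in tT tJ1 tJ2 tJ3.
have tS : t^T = - t by apply: oppr_inj; rewrite -tT raddfN.
have [u1 u2 u3] : [/\ \tr J1 = 0, \tr J2 = 0 & \tr J3 = 0].
  have := pq_trace_comm J (K := 1%:M); rewrite !mulmx1 !mul1mx; exact.
have [v1 v2 v3] := curvature_trace0 c d.
have N J0 : J0^T *m - t = - (- t *m J0) -> J0^T *m t = - (t *m J0).
  by rewrite mulmxN mulNmx opprK => <-; rewrite opprK.
have [] := orthogonal_selfdual hg sd1 sd2 sd3 (weyl_mx_antisym c d) _ _ _.
- by apply: weyl_mx_trace0 => //; [exact: nc_skew1 hg|exact: N].
- by apply: weyl_mx_trace0 => //; [exact: nc_skew2 hg|exact: N].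
- by apply: weyl_mx_trace0 => //; [exact: nc_skew3 hg|exact: N].
by [].
Qed.
End ObataCurvature.

(** * Extraction of the Weyl tensor from the decomposed curvature *)

Section Decomposition.
Context {R : realType}.
Variable g : 'M[R]_4.
Hypotheses (gT : g^T = g) (gU : g \in unitmx).
Variables (Q Rm : 'I_4 -> 'I_4 -> 'M[R]_4) (t K : 'M[R]_4).
Hypothesis ricciQ : ricci_mx Q = - t.
Hypothesis skewK : forall i j, K i j - K j i = 2^-1 * t i j.
Hypothesis RmE : forall i j,
  Rm i j = Q i j + 2^-1 *: (t i j *: 1%:M) + kulkarni_nomizu g K i j.

(** [Q] contributes - t and the scalar term 1/2 t; by [skewK] the remaining - 1/2 t is exactly what
    symmetrizes the term - 2 K_jk of the Kulkarni-Nomizu product. *)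
Lemma ricci_decomposition k j : \sum_i Rm i j i k = - K k j - K j k - metric_trace g K * g k j.
Proof.
have E i : Rm i j i k = Q i j i k + 2^-1 * (t i j * (i == k)%:R) + kulkarni_nomizu g K i j i k.
  by rewrite RmE !mxE_lin [1%:M _ _]mxE.
under eq_bigr => i _ do rewrite E.
rewrite !big_split /= (ricci_kulkarni_nomizu gT gU) -mulr_sumr.
have -> : \sum_i t i j * (i == k)%:R = t k j.
  by rewrite (bigD1 k) //= eqxx mulr1 big1 ?addr0 // => i /negbTE ->; rewrite mulr0.
have -> : \sum_i Q i j i k = - t k j by rewrite -mxE_opp -ricciQ mxE.
have gS : g k j = g j k by rewrite -{1}gT mxE.
have := skewK k j; rewrite gS; lra.
Qed.

Lemma scalar_decomposition (h := invmx g) :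
  \sum_k \sum_j h k j * (\sum_i Rm i j i k) = - (6 * metric_trace g K).
Proof.
have E k j : h k j * (\sum_i Rm i j i k) =
    - (h k j * K k j) - h k j * K j k - metric_trace g K * (h k j * g j k).
  have gS : g k j = g j k by rewrite -{1}gT mxE.
  rewrite ricci_decomposition gS; ring.
under eq_bigr => k _ do under eq_bigr => j _ do rewrite E.
have hS k j : h k j = h j k by rewrite -[in RHS](trmxK h) mxE trmx_inv gT.
have e1 : \sum_k \sum_j h k j * K k j = metric_trace g K.
  apply: eq_bigr => k _; rewrite mxE; apply: eq_bigr => j _; by rewrite [K^T _ _]mxE.
have e2 : \sum_k \sum_j h k j * K j k = metric_trace g K.
  rewrite exchange_big -e1; apply: eq_bigr => k _; apply: eq_bigr => j _.
  by rewrite hS.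
have e3 : \sum_k \sum_j h k j * g j k = 4.
  transitivity (\tr (h *m g)); last by rewrite mulVmx // mxtrace1.
  by apply: eq_bigr => k _; rewrite mxE.
under eq_bigr => k _ do rewrite !sumrB sumrN -mulr_sumr.
rewrite !sumrB sumrN -mulr_sumr e1 e2 e3; ring.
Qed.

(** The Ricci and scalar terms remove the symmetric part of [K]; what survives is its skew part, 1/4
    t by [skewK]. *)
Lemma weyl_decomposition a b c d (ric := fun k j => \sum_i Rm i j i k)
  (s := \sum_k \sum_j invmx g k j * ric k j) :
  (g *m Rm c d) a b
  - 2^-1 * (g a c * ric b d - g a d * ric b c + g b d * ric a c - g b c * ric a d)
  + 6^-1 * s * (g a c * g b d - g a d * g b c)
  = (g *m Q c d) a b + 2^-1 * (t c d * g a b)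
  + 4%:R^-1 * (g a d * t c b - g a c * t d b - t c a * g d b + t d a * g c b).
Proof.
rewrite /s scalar_decomposition /ric !ricci_decomposition RmE.
rewrite (mulmxDr g (_ + _)) (mulmxDr g (Q c d)) -!scalemxAr mulmx1.
rewrite !mxE_lin low_kulkarni_nomizu //.
have T i j : t i j = 2 * (K i j - K j i) by rewrite skewK; field.
have gS i j : g i j = g j i by rewrite -{1}gT mxE.
rewrite (T c b) (T d b) (T c a) (T d a) (gS d b) (gS c b).
by field.
Qed.
End Decomposition.

(** * From a Weyl connection to the Levi-Civita connection *)

Section WeylConnection.
Context {R : realType}.
Variables (g : 'M[R]_4) (B : 'I_4 -> 'M[R]_4) (dB : 'I_4 -> 'I_4 -> 'M[R]_4).
Variables (tau : 'rV[R]_4) (u : 'cV[R]_4) (dtau : 'I_4 -> 'rV[R]_4)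
  (du : 'I_4 -> 'cV[R]_4) (dg : 'I_4 -> 'M[R]_4).
Hypotheses (gT : g^T = g) (gU : g \in unitmx).
Hypothesis torsionfree : forall i j, B i *m e_ j = B j *m e_ i :> 'cV[R]_4.
Hypothesis dgE : forall i, dg i = tau 0 i *: g + (B i)^T *m g + g *m B i.
Hypothesis tauE : tau = u^T *m g.
Hypothesis dtauE : forall i, dtau i = (du i)^T *m g + u^T *m dg i.

(* If a torsion-free connection [B] satisfies [D g = tau g], then the Levi-Civita
   connection of [g] is [B + weyl_shift], with [u] the vector dual to [tau]. *)
Definition weyl_shift i : 'M[R]_4 :=
  2^-1 *: (tau 0 i *: 1%:M + e_ i *m tau - u *m row i g).
(** The formal derivative of [weyl_shift j] in direction [i]; [dtau], [du] and [dg] stand for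
    derivatives at a fixed point. *)
Definition dweyl_shift i j : 'M[R]_4 :=
  2^-1 *: (dtau i 0 j *: 1%:M + e_ j *m dtau i - (du i *m row j g + u *m row j (dg i))).

Definition curvature i j : 'M[R]_4 := dB i j - dB j i + (B i *m B j - B j *m B i).
Definition dtau_mx : 'M[R]_4 := \matrix_(i, j) (dtau i 0 j - dtau j 0 i).

(** The covariant derivative of tau for [B], followed by the squared norm of tau. *)
Let h i : 'rV[R]_4 := dtau i - tau *m B i.
Let N : R := (tau *m u) 0 0.
(* K = 1/2 D tau - 1/4 tau (x) tau + 1/8 |tau|^2 g *)
Definition shift_schouten : 'M[R]_4 :=
  \matrix_(i, j) (2^-1 * h i 0 j - 4%:R^-1 * (tau 0 i * tau 0 j) + 8%:R^-1 * N * g i j).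

Lemma tau_entry i : (g *m u) i 0 = tau 0 i.
Proof. by rewrite tauE -{2}gT -trmx_mul [RHS]mxE. Qed.

Let v i := invmx g *m (h i)^T.
(** Raising an index does not commute with D: since D g = tau g, the derivative of [u] is the raised
    derivative of tau minus a multiple of [u]. *)
Lemma du_eq i : du i = v i - B i *m u - tau 0 i *: u.
Proof.
have e : h i = (du i)^T *m g + tau 0 i *: (u^T *m g) + (B i *m u)^T *m g.
  by rewrite /h dtauE dgE {2}tauE trmx_mul; mx_distr; mx_linear.
have gV : g *m invmx g = 1%:M by rewrite mulmxV.
have hT : (invmx g)^T = invmx g by rewrite trmx_inv gT.
have e' : v i = du i + tau 0 i *: u + B i *m u.
  apply: trmx_inj; rewrite /v trmx_mul trmxK hT e !mulmxDl -!scalemxAl -!mulmxA gV !mulmx1.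
  by rewrite !linearD linearZ.
rewrite e'; mx_linear.
Qed.

Lemma row_dg i j : row j (dg i) = tau 0 i *: row j g + (B j *m e_ i)^T *m g + row j g *m B i.
Proof.
rewrite dgE !linearD linearZ /= -torsionfree -row_mul; congr (_ + _ + _).
by rewrite rowE trmx_mul trmx_delta mulmxA.
Qed.

Lemma row_shift_schouten i : row i shift_schouten =
  2^-1 *: h i - (4%:R^-1 * tau 0 i) *: tau + (8%:R^-1 * N) *: row i g.
Proof. by apply/rowP => j; rewrite !(mxE_lin, mxE) mulrA. Qed.

Lemma raise_shift_schouten i : invmx g *m (row i shift_schouten)^T =
  2^-1 *: v i - (4%:R^-1 * tau 0 i) *: u + (8%:R^-1 * N) *: e_ i.
Proof.
have hg : invmx g *m g = 1%:M by rewrite mulVmx.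
rewrite row_shift_schouten linearD linearB !linearZ /= 2!mulmxDr -!scalemxAr mulmxN -/(v i).
congr (_ + _ *: - _ + _ *: _).
  by rewrite tauE trmx_mul trmxK gT mulmxA hg mul1mx.
by rewrite tr_row gT colE mulmxA hg mul1mx.
Qed.

Lemma skew_shift_schouten i j : shift_schouten i j - shift_schouten j i = 2^-1 * dtau_mx i j.
Proof.
have gS : g j i = g i j by rewrite -{1}gT mxE.
have b : (tau *m B i) 0 j = (tau *m B j) 0 i.
  have E k l : (tau *m B k) 0 l = (tau *m (B k *m e_ l)) 0 0.
    by rewrite mulmxA -colE [RHS]mxE.
  by rewrite !E torsionfree.
have sE k l : shift_schouten k l =
    2^-1 * h k 0 l - 4%:R^-1 * (tau 0 k * tau 0 l) + 8%:R^-1 * N * g k l by rewrite mxE.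
have hE k l : h k 0 l = dtau k 0 l - (tau *m B k) 0 l by rewrite mxE_add mxE_opp.
have tE : dtau_mx i j = dtau i 0 j - dtau j 0 i by rewrite mxE.
by rewrite !sE !hE tE b gS; field.
Qed.

Lemma weyl_shift_curvature i j :
  dB i j + dweyl_shift i j - (dB j i + dweyl_shift j i)
  + ((B i + weyl_shift i) *m (B j + weyl_shift j)
     - (B j + weyl_shift j) *m (B i + weyl_shift i))
  = curvature i j + 2^-1 *: (dtau_mx i j *: 1%:M) + kulkarni_nomizu g shift_schouten i j.
Proof.
rewrite /kulkarni_nomizu !raise_shift_schouten !row_shift_schouten /curvature.
rewrite /weyl_shift /dweyl_shift !row_dg !du_eq.
have dt k : dtau k = h k + tau *m B k by rewrite /h subrK.
(* Once all derivatives are expressed through [h] and [v], each row meeting a column inside a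
   product contracts to a scalar; the claim then becomes linear in the remaining words. *)
have wt m (w : 'cV_m) k : w *m tau *m e_ k = tau 0 k *: w.
  by rewrite -mulmxA -colE -mul_mx_scalar; congr (_ *m _);
    apply/matrixP => a b; rewrite !ord1 !mxE.
have wu m (w : 'cV_m) : w *m tau *m u = N *: w.
  by rewrite -mulmxA -mul_mx_scalar; congr (_ *m _);
    apply/matrixP => a b; rewrite !ord1 /N [RHS]mxE.
have wg m (w : 'cV_m) k l : w *m row k g *m e_ l = g k l *: w.
  by rewrite -mulmxA -colE -mul_mx_scalar; congr (_ *m _);
    apply/matrixP => a b; rewrite !ord1 !mxE.
have wgu m (w : 'cV_m) k : w *m row k g *m u = tau 0 k *: w.
  rewrite -mulmxA -row_mul -mul_mx_scalar; congr (_ *m _); apply/matrixP => a b.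
  by rewrite !ord1 [LHS]mxE tau_entry mxE.
have gS : g j i = g i j by rewrite -{1}gT mxE.
have dtij k l : dtau k 0 l = h k 0 l + (tau *m B k) 0 l by rewrite dt mxE.
have b : (tau *m B j) 0 i = (tau *m B i) 0 j.
  have E k l : (tau *m B k) 0 l = (tau *m (B k *m e_ l)) 0 0.
    by rewrite mulmxA -colE [RHS]mxE.
  by rewrite !E torsionfree.
have -> : dtau_mx i j = h i 0 j - h j 0 i by rewrite mxE !dtij b; ring.
rewrite !dtij b !dt -!/(v _) -/(e_ _) -!/(e_ i) -!/(e_ j).
mx_distr; rewrite ?(wt, wu, wg, wgu, torsionfree j i, gS).
mx_distr.
apply/matrixP=> a c; rewrite ?mxE_lin; by field.
Qed.

End WeylConnection.

Section ConnectionAlgebra.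
Context {R : realType}.
Variables (g : 'M[R]_4) (B : 'I_4 -> 'M[R]_4) (dB : 'I_4 -> 'I_4 -> 'M[R]_4).
Variables (tau : 'rV[R]_4) (u : 'cV[R]_4) (dtau : 'I_4 -> 'rV[R]_4)
  (dg : 'I_4 -> 'M[R]_4).

Lemma entry_mulmx_e n (A : 'M[R]_(n, 4)) a b : A a b = (A *m e_ b) a 0.
Proof. by rewrite -colE mxE. Qed.

(** The third hypothesis is the derivative of the second. With [J] parallel, the covariant
    derivative of [g] inherits the skewness. *)
Lemma parallel_skew (A J dJ D : 'M[R]_4) : dJ = J *m A - A *m J -> J^T *m g = - (g *m J) ->
  dJ^T *m g + J^T *m D = - (D *m J + g *m dJ) ->
  J^T *m (D - A^T *m g - g *m A) = - ((D - A^T *m g - g *m A) *m J).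
Proof.
move=> -> e0; rewrite linearB /= !trmx_mul => e.
have w m (w : 'M[R]_(m, 4)) : w *m J^T *m g = - (w *m g *m J).
  by rewrite -!mulmxA e0 mulmxN mulmxA.
move: e; mx_distr; rewrite ?(w, e0); mx_distr => e.
by apply: (eq_from_sub e); mx_linear.
Qed.

Lemma curvature_antisym i j : curvature B dB j i = - curvature B dB i j.
Proof. by rewrite /curvature opprD !opprB. Qed.

(** The Ricci identity for a parallel [J]: the second hypothesis equates its mixed second
    derivatives, each expanded by the product rule. *)
Lemma curvature_comm (J : 'M[R]_4) (dJ : 'I_4 -> 'M[R]_4) i j :
  (forall k, dJ k = J *m B k - B k *m J) ->
  dJ i *m B j + J *m dB i j - (dB i j *m J + B j *m dJ i) =
  dJ j *m B i + J *m dB j i - (dB j i *m J + B i *m dJ j) ->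
  J *m curvature B dB i j = curvature B dB i j *m J.
Proof.
rewrite /curvature => dJE; rewrite !dJE; mx_distr => e.
by apply: (eq_from_sub e); mx_linear.
Qed.

Hypotheses (gT : g^T = g) (gU : g \in unitmx).
Hypothesis torsionfree : forall i j, B i *m e_ j = B j *m e_ i :> 'cV[R]_4.

Lemma curvature_bianchi : (forall k i j, dB k i *m e_ j = dB k j *m e_ i :> 'cV[R]_4) ->
  forall i j k l, curvature B dB i j l k + curvature B dB j k l i + curvature B dB k i l j = 0.
Proof.
move=> dtf i j k l; rewrite !entry_mulmx_e -!mxE_add.
suff -> : curvature B dB i j *m e_ k + curvature B dB j k *m e_ i
    + curvature B dB k i *m e_ j = 0 by rewrite mxE_zero.
rewrite /curvature !mulmxDl !mulNmx -!mulmxA.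
rewrite (torsionfree k j) (torsionfree i k) (torsionfree j i).
rewrite (dtf k j i) (dtf i j k) (dtf j i k); mx_linear.
Qed.

Hypothesis dgE : forall i, dg i = tau 0 i *: g + (B i)^T *m g + g *m B i.

(** The same identity for D g = tau g: the products tau_i tau_j cancel by symmetry, and only d tau
    is left. *)
Lemma curvature_metricity i j :
  dtau i 0 j *: g + tau 0 j *: dg i + ((dB i j)^T *m g + (B j)^T *m dg i)
    + (dg i *m B j + g *m dB i j) =
  dtau j 0 i *: g + tau 0 i *: dg j + ((dB j i)^T *m g + (B i)^T *m dg j)
    + (dg j *m B i + g *m dB j i) ->
  (curvature B dB i j)^T *m g + g *m curvature B dB i j = - (dtau_mx dtau i j *: g).
Proof.
have -> : dtau_mx dtau i j = dtau i 0 j - dtau j 0 i by rewrite mxE.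
have trD (X Y : 'M[R]_4) : (X + Y)^T = X^T + Y^T by exact: linearD.
have trN (X : 'M[R]_4) : (- X)^T = - X^T by exact: linearN.
rewrite !dgE /curvature !(trD, trN) !trmx_mul.
mx_distr => e; apply: (eq_from_sub e); mx_linear.
Qed.

Hypothesis tauE : tau = u^T *m g.

(** In the Koszul combination, torsion-freeness in the form [gB] cancels the connection terms except
    for twice [g *m B i]; the terms in tau make up the shift. *)
Lemma christoffel_shift i j k :
  2^-1 * (\sum_l invmx g k l * (dg i j l + dg j i l - dg l i j)) =
  (B i + weyl_shift g tau u i) k j.
Proof.
have gS p q : g q p = g p q by rewrite -{1}gT mxE.
have dg_entry p q r : dg p q r = tau 0 p * g q r + (g *m B p) r q + (g *m B p) q r.
  rewrite dgE !mxE_lin; congr (_ + _ + _).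
  by rewrite -{1}gT -trmx_mul mxE.
have gB p q r : (g *m B p) q r = (g *m B r) q p.
  by rewrite !(entry_mulmx_e (_ *m _)) -!mulmxA torsionfree.
have gSS l : (g *m weyl_shift g tau u i) l j =
    2^-1 * (tau 0 i * g l j + g l i * tau 0 j - tau 0 l * g i j).
  have outer (c : 'cV[R]_4) (r : 'rV[R]_4) : (c *m r) l j = c l 0 * r 0 j.
    by rewrite mxE big_ord1.
  rewrite /weyl_shift -scalemxAr mulmxBr mulmxDr -scalemxAr mulmx1.
  rewrite !mulmxA -colE !mxE_lin !outer (tau_entry gT tauE).
  by rewrite [col i g _ _]mxE [row i g _ _]mxE.
transitivity ((invmx g *m (g *m (B i + weyl_shift g tau u i))) k j); last first.
  by rewrite mulmxA mulVmx ?mul1mx.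
rewrite [RHS]mxE mulr_sumr; apply: eq_bigr => l _.
rewrite (mulmxDr g) mxE_add gSS !dg_entry.
rewrite (gB j l i) (gB l j i) (gB j i l) (gB l i j) (gS j l) (gS i l).
by field.
Qed.
End ConnectionAlgebra.

(** * Anti-self-duality in a chart *)

Section DerivableMatrices.
Context {R : realType} {U : normedModType R}.
Variables (x v : U).

Lemma derivable_addmx m n (F G : U -> 'M[R]_(m, n)) : derivable F x v -> derivable G x v ->
  derivable (fun y => F y + G y) x v.
Proof. exact: derivableD. Qed.

Lemma derivable_oppmx m n (F : U -> 'M[R]_(m, n)) : derivable F x v ->
  derivable (fun y => - F y) x v.
Proof. exact: derivableN. Qed.

Lemma derivable_mulmx m n p (F : U -> 'M[R]_(m, n)) (G : U -> 'M[R]_(n, p)) :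
  derivable F x v -> derivable G x v -> derivable (fun y => F y *m G y) x v.
Proof. by move=> /derivableP hF /derivableP hG; have [] := is_derive_mulmx hF hG. Qed.

Lemma derivable_trmx m n (F : U -> 'M[R]_(m, n)) :
  derivable F x v -> derivable (fun y => (F y)^T) x v.
Proof. by move=> /derivableP hF; have [] := is_derive_trmx hF. Qed.

Lemma derivable_scalemx m n (f : U -> R) (F : U -> 'M[R]_(m, n)) :
  derivable f x v -> derivable F x v -> derivable (fun y => f y *: F y) x v.
Proof. by move=> /derivableP hF /derivableP hG; have [] := is_derive_scalemx hF hG. Qed.

Lemma derivable_entry m n (F : U -> 'M[R]_(m, n)) i j :
  derivable F x v -> derivable (fun y => F y i j) x v.
Proof. by move/derivable_mxP; apply. Qed.

Lemma derivable_summx (I : Type) (r : seq I) m n (F : I -> U -> 'M[R]_(m, n)) :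
  (forall i, derivable (F i) x v) -> derivable (fun y => \sum_(i <- r) F i y) x v.
Proof.
move=> hF; apply/derivable_mxP => a b.
have -> : (fun y => (\sum_(i <- r) F i y) a b) = (fun y => \sum_(i <- r) F i y a b).
  by apply/funext => y; rewrite summxE.
by apply: derivable_bigsum => i; apply: derivable_entry.
Qed.

End DerivableMatrices.

Ltac derivable_mx := lazymatch goal with
  | |- derivable (fun=> ?A) _ _ => exact: derivable_cst
  | |- derivable (fun y => @?F y + @?G y) _ _ =>
      apply: (@derivable_addmx _ _ _ _ _ _ F G); derivable_mx
  | |- derivable (fun y => - @?F y) _ _ =>
      apply: (@derivable_oppmx _ _ _ _ _ _ F); derivable_mx
  | |- derivable (fun y => @?F y *m @?G y) _ _ =>
      apply: (@derivable_mulmx _ _ _ _ _ _ _ F G); derivable_mx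
  | |- derivable (fun y => (@?F y)^T) _ _ =>
      apply: (@derivable_trmx _ _ _ _ _ _ F); derivable_mx
  | |- derivable (fun y => @?f y *: @?F y) _ _ =>
      apply: (@derivable_scalemx _ _ _ _ _ _ f F); derivable_mx
  | |- derivable (fun y => \sum_(i <- _) _) _ _ =>
      apply: derivable_summx => ?; derivable_mx
  | |- derivable (fun y => fun_of_matrix (@?F y) ?i ?j) _ _ =>
      apply: (@derivable_entry _ _ _ _ _ _ F i j); derivable_mx
  | |- _ => idtac
  end.

Section Local.
Context {R : realType}.
Variables (V : set (vec4 R)) (g J1 J2 J3 : vec4 R -> 'M[R]_4) (o : vec4 R -> R).
Hypothesis oV : open V.
Hypotheses (sg : smooth_mx V g) (s1 : smooth_mx V J1) (s2 : smooth_mx V J2)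
  (s3 : smooth_mx V J3).
Hypothesis hg : forall y, V y -> neutral_compatible (g y) (J1 y) (J2 y) (J3 y).
Hypothesis sd : forall y, V y -> [/\ self_dual (g y) (o y) (g y *m J1 y),
  self_dual (g y) (o y) (g y *m J2 y) & self_dual (g y) (o y) (g y *m J3 y)].
Hypothesis N1 : forall y X Y, V y -> nijenhuis J1 (fun=> X) (fun=> Y) y = 0.
Hypothesis N2 : forall y X Y, V y -> nijenhuis J2 (fun=> X) (fun=> Y) y = 0.
Hypothesis N3 : forall y X Y, V y -> nijenhuis J3 (fun=> X) (fun=> Y) y = 0.

Let nearV y : V y -> \forall z \near y, V z.
Proof. by move=> Vy; apply: open_nbhs_nbhs. Qed.

Let pq y (Vy : V y) := nc_pq (hg Vy).

Definition obata_field i y : 'M[R]_4 :=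
  obata (J1 y) (J2 y) (J3 y) (fun l => 'D_(e_ l) J1 y) (fun l => 'D_(e_ l) J2 y)
    (fun l => 'D_(e_ l) J3 y) i.
Notation B := obata_field.

Lemma obata_field_derivable i j y : V y -> derivable (B i) y (e_ j).
Proof.
move=> Vy.
have d1 := smooth_derivable s1 j Vy; have d2 := smooth_derivable s2 j Vy.
have d3 := smooth_derivable s3 j Vy.
have dd1 k := smooth_derivable2 s1 oV k j Vy.
have dd2 k := smooth_derivable2 s2 oV k j Vy.
have dd3 k := smooth_derivable2 s3 oV k j Vy.
have dA k : derivable (fun y => pq_connection (J1 y) (J2 y) (J3 y) (fun l => 'D_(e_ l) J1 y)
    (fun l => 'D_(e_ l) J2 y) (fun l => 'D_(e_ l) J3 y) k) y (e_ j).
  rewrite /pq_connection; derivable_mx;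
    [exact: dd1|exact: d1|exact: dd2|exact: d2|exact: dd3|exact: d3].
rewrite /obata_field /obata /torsion_correction /torsion /along.
derivable_mx.
all: lazymatch goal with
  | |- derivable (fun y => J1 y) _ _ => exact: d1
  | |- derivable (fun y => J2 y) _ _ => exact: d2
  | |- derivable (fun y => J3 y) _ _ => exact: d3
  | |- _ => exact: dA
  end.
Qed.

(** The device for differentiating an identity valid on [V]: its two sides are differentiated by
    separate rules and the results equated. *)
Let derive_unique m n (F G : vec4 R -> 'M[R]_(m, n)) dF dG i y : V y ->
  (forall z, V z -> F z = G z) ->
  is_derive y (e_ i) F dF -> is_derive y (e_ i) G dG -> dF = dG.
Proof.
move=> Vy FG [_ <-] [_ <-]; apply: near_eq_derive.
by apply: filterS (nearV Vy) => z; apply: FG.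
Qed.

Let D1 i y (Vy : V y) := smooth_is_derive s1 i Vy.
Let D2 i y (Vy : V y) := smooth_is_derive s2 i Vy.
Let D3 i y (Vy : V y) := smooth_is_derive s3 i Vy.

Let square_derive (J : vec4 R -> 'M[R]_4) (c : 'M[R]_4) i y :
  smooth_mx V J -> V y -> (forall z, V z -> J z *m J z = c) ->
  'D_(e_ i) J y *m J y + J y *m 'D_(e_ i) J y = 0.
Proof.
move=> sJ Vy hJ; have d := smooth_is_derive sJ i Vy.
exact: (derive_unique Vy hJ (is_derive_mulmx d d) (is_derive_cst c _ _)).
Qed.

Lemma obata_field_parallel i y : V y ->
  [/\ 'D_(e_ i) J1 y = J1 y *m B i y - B i y *m J1 y,
      'D_(e_ i) J2 y = J2 y *m B i y - B i y *m J2 y &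
      forall j, B i y *m e_ j = B j y *m e_ i :> vec4 R].
Proof.
move=> Vy; have J := pq Vy.
have e1 l : 'D_(e_ l) J1 y *m J1 y + J1 y *m 'D_(e_ l) J1 y = 0.
  by apply: (square_derive _ s1) => // z Vz; exact: pq11 (pq Vz).
have e2 l : 'D_(e_ l) J2 y *m J2 y + J2 y *m 'D_(e_ l) J2 y = 0.
  by apply: (square_derive _ s2) => // z Vz; exact: pq22 (pq Vz).
have e12 l : 'D_(e_ l) J3 y = 'D_(e_ l) J1 y *m J2 y + J1 y *m 'D_(e_ l) J2 y.
  apply: (derive_unique Vy _ (D3 l Vy) (is_derive_mulmx (D1 l Vy) (D2 l Vy))).
  by move=> z Vz; rewrite (pq12 (pq Vz)).
have e21 l : 'D_(e_ l) J3 y = - ('D_(e_ l) J2 y *m J1 y + J2 y *m 'D_(e_ l) J1 y).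
  apply: (derive_unique Vy _ (D3 l Vy) (is_deriveN (is_derive_mulmx (D2 l Vy) (D1 l Vy)))).
  by move=> z Vz; rewrite -[J3 z]opprK -(pq21 (pq Vz)).
have n1 X Y := etrans (esym (nijenhuis_cst X Y (fun l => smooth_derivable s1 l Vy))) (N1 X Y Vy).
have n2 X Y := etrans (esym (nijenhuis_cst X Y (fun l => smooth_derivable s2 l Vy))) (N2 X Y Vy).
have n3 X Y := etrans (esym (nijenhuis_cst X Y (fun l => smooth_derivable s3 l Vy))) (N3 X Y Vy).
split.
- exact: (obata_parallel1 J e1 e2 e12 e21 n1).
- exact: (obata_parallel2 J e1 e2 e12 e21).
- by move=> j; exact: (obata_torsion_free J e1 e2 e12 e21 n1 n2 n3).
Qed.

(** The factor found in [compatible_proportional], applied to the covariant derivative of [g]; as an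
    explicit trace it is visibly differentiable. *)
Definition lee_form y : 'rV[R]_4 := \row_i (4%:R^-1 * \tr (invmx (g y) *m
  ('D_(e_ i) g y - (B i y)^T *m g y - g y *m B i y))).
Definition lee_vector y : vec4 R := invmx (g y) *m (lee_form y)^T.

Let gU y : V y -> \forall z \near y, g z \in unitmx.
Proof. by move=> Vy; apply: filterS (nearV Vy) => z Vz; exact: nc_unit (hg Vz). Qed.

Let invmx_g_derivable i y : V y -> derivable (fun z => invmx (g z)) y (e_ i).
Proof.
move=> Vy; exact: (derivable_invmx (gU Vy) (smooth_derivable sg i Vy)).
Qed.

Lemma lee_form_derivable i y : V y -> derivable lee_form y (e_ i).
Proof.
move=> Vy; apply/derivable_mxP => a j.
have -> : (fun z => lee_form z a j) = (fun z => 4%:R^-1 * \tr (invmx (g z) *m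
    ('D_(e_ j) g z - (B j z)^T *m g z - g z *m B j z))).
  by apply/funext => z; rewrite mxE.
apply: derivable_mulfun; first exact: derivable_cst.
apply: derivable_mxtrace; derivable_mx; lazymatch goal with
  | |- derivable (fun y => g y) _ _ => exact: (smooth_derivable sg i Vy)
  | |- derivable (fun y => invmx (g y)) _ _ => exact: invmx_g_derivable
  | |- derivable (fun y => obata_field _ y) _ _ => exact: obata_field_derivable
  | |- _ => exact: (smooth_derivable2 sg oV j i Vy)
  end.
Qed.

Lemma lee_vector_derivable i y : V y -> derivable lee_vector y (e_ i).
Proof.
move=> Vy; rewrite /lee_vector; derivable_mx.
  exact: invmx_g_derivable.
exact: lee_form_derivable.
Qed.

Lemma lee_formE y : V y -> lee_form y = (lee_vector y)^T *m g y.
Proof.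
move=> Vy; rewrite /lee_vector trmx_mul trmxK trmx_inv (nc_sym (hg Vy)).
by rewrite -mulmxA mulVmx ?mulmx1 ?(nc_unit (hg Vy)).
Qed.

Let Dg i y (Vy : V y) := smooth_is_derive sg i Vy.

(** The covariant derivative of [g] may be degenerate, but it satisfies the same linear symmetry and
    skewness conditions as [g], which is all that proportionality asks of it. *)
Lemma metric_derive i y : V y ->
  'D_(e_ i) g y = lee_form y 0 i *: g y + (B i y)^T *m g y + g y *m B i y.
Proof.
move=> Vy; have [p1 p2 _] := obata_field_parallel i Vy.
have h := hg Vy; have [a1 a2 a3] := sd Vy.
have gS : ('D_(e_ i) g y)^T = 'D_(e_ i) g y.
  apply: (derive_unique Vy _ (is_derive_trmx (Dg i Vy)) (Dg i Vy)) => z Vz.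
  exact: nc_sym (hg Vz).
pose H := 'D_(e_ i) g y - (B i y)^T *m g y - g y *m B i y.
have skew (J : vec4 R -> 'M[R]_4) : smooth_mx V J ->
    'D_(e_ i) J y = J y *m B i y - B i y *m J y ->
    (forall z, V z -> (J z)^T *m g z = - (g z *m J z)) -> (J y)^T *m H = - (H *m J y).
  move=> sJ pJ hJ; have dJ := smooth_is_derive sJ i Vy.
  have := derive_unique Vy hJ (is_derive_mulmx (is_derive_trmx dJ) (Dg i Vy))
    (is_deriveN (is_derive_mulmx (Dg i Vy) dJ)).
  exact: parallel_skew pJ (hJ _ Vy).
have HS : H^T = H.
  have trB (X Y : 'M[R]_4) : (X - Y)^T = X^T - Y^T by exact: linearB.
  by rewrite /H !trB !trmx_mul trmxK gS (nc_sym h) addrAC.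
have := compatible_proportional h a1 a2 a3 HS (skew _ s1 p1 (fun z Vz => nc_skew1 (hg Vz)))
  (skew _ s2 p2 (fun z Vz => nc_skew2 (hg Vz))).
have -> : 4%:R^-1 * \tr (invmx (g y) *m H) = lee_form y 0 i by rewrite mxE.
by move=> <-; rewrite /H; mx_linear.
Qed.

Definition christoffel_mx i y : 'M[R]_4 := \matrix_(k, j) christoffel g k i j y.

Lemma christoffel_mxE i y : V y ->
  christoffel_mx i y = B i y + weyl_shift (g y) (lee_form y) (lee_vector y) i.
Proof.
move=> Vy; have h := hg Vy; have [_ _ sym] := obata_field_parallel i Vy.
apply/matrixP => k j; rewrite mxE /christoffel.
rewrite -(christoffel_shift (dg := fun l => 'D_(e_ l) g y) (nc_sym h) (nc_unit h) _
  (fun l => metric_derive l Vy) (lee_formE Vy)).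
  have dE p q r : partial p (fun z => g z q r) y = 'D_(e_ p) g y q r.
    by apply/esym; apply: (smooth_derive_entry sg).
  by congr (_ * _); apply: eq_bigr => l _; rewrite !dE.
by move=> p q; have [_ _] := obata_field_parallel p Vy.
Qed.

Section AtPoint.
Variable x : vec4 R.
Hypothesis Vx : V x.
Let tau := lee_form x.
Let u := lee_vector x.
Let dtau i := 'D_(e_ i) lee_form x.
Let du i := 'D_(e_ i) lee_vector x.
Let dg i := 'D_(e_ i) g x.
Let dB i j := 'D_(e_ i) (B j) x.
Let Bx i := B i x.
Let h := hg Vx.
Let Dtau i : is_derive x (e_ i) lee_form (dtau i) := derivableP (lee_form_derivable (i:=i) Vx).
Let Du i : is_derive x (e_ i) lee_vector (du i) := derivableP (lee_vector_derivable (i:=i) Vx).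
Let DB i j : is_derive x (e_ i) (B j) (dB i j) :=
  derivableP (obata_field_derivable (i:=j) (j:=i) Vx).
Let Q := curvature Bx dB.
Let t := dtau_mx dtau.

Let dtauE i : dtau i = (du i)^T *m g x + u^T *m dg i.
Proof.
exact: (derive_unique Vx lee_formE (Dtau i)
  (is_derive_mulmx (is_derive_trmx (Du i)) (Dg i Vx))).
Qed.

Let torsionfree i j : Bx i *m e_ j = Bx j *m e_ i.
Proof. by have [_ _] := obata_field_parallel i Vx. Qed.

Let dtorsionfree k i j : dB k i *m e_ j = dB k j *m e_ i.
Proof.
have D a b : is_derive x (e_ k) (fun z => B a z *m e_ b) (dB k a *m e_ b).
  apply: is_derive_eq (is_derive_mulmx (DB k a) (is_derive_cst (e_ b) x (e_ k))) _.
  by rewrite [B a x *m 0]mulmx0 addr0.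
by apply: (derive_unique Vx _ (D i j) (D j i)) => z Vz; have [_ _] := obata_field_parallel i Vz.
Qed.

Let comm (J : vec4 R -> 'M[R]_4) i j : smooth_mx V J ->
  (forall k z, V z -> 'D_(e_ k) J z = J z *m B k z - B k z *m J z) ->
  J x *m Q i j = Q i j *m J x.
Proof.
move=> sJ pJ; apply: (curvature_comm (dJ := fun k => 'D_(e_ k) J x)) => [k|].
  exact: pJ.
have dJ k := smooth_is_derive sJ k Vx.
have second k l : 'D_(e_ k) ('D_(e_ l) J) x =
    'D_(e_ k) J x *m B l x + J x *m dB k l - (dB k l *m J x + B l x *m 'D_(e_ k) J x).
  apply: (derive_unique Vx (pJ l) (smooth_is_derive2 sJ oV l k Vx)).
  exact: (is_deriveB (is_derive_mulmx (dJ k) (DB k l)) (is_derive_mulmx (DB k l) (dJ k))).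
exact: etrans (esym (second i j)) (etrans (smooth_schwarz sJ oV j i Vx) (second j i)).
Qed.

Let metricity i j : (Q i j)^T *m g x + g x *m Q i j = - (t i j *: g x).
Proof.
apply: (curvature_metricity (tau := tau) (dg := dg)) => [k|].
  exact: metric_derive.
have second k l : 'D_(e_ k) ('D_(e_ l) g) x =
    dtau k 0 l *: g x + tau 0 l *: dg k + ((dB k l)^T *m g x + (Bx l)^T *m dg k)
    + (dg k *m Bx l + g x *m dB k l).
  apply: (derive_unique Vx (fun z Vz => metric_derive l Vz) (smooth_is_derive2 sg oV l k Vx)).
  have dt : is_derive x (e_ k) (fun z => lee_form z 0 l) (dtau k 0 l).
    by have /is_derive_mxP := Dtau k; apply.
  exact: (is_deriveD (is_deriveD (is_derive_scalemx dt (Dg k Vx))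
    (is_derive_mulmx (is_derive_trmx (DB k l)) (Dg k Vx))) (is_derive_mulmx (Dg k Vx) (DB k l))).
exact: etrans (esym (second i j)) (etrans (smooth_schwarz sg oV j i Vx) (second j i)).
Qed.

Let dGamma i j : is_derive x (e_ i) (christoffel_mx j)
  (dB i j + dweyl_shift (g x) u dtau du dg i j).
Proof.
have E : {near x, (fun y => B j y + weyl_shift (g y) (lee_form y) (lee_vector y) j) =1
    christoffel_mx j}.
  by apply: filterS (nearV Vx) => z Vz; rewrite christoffel_mxE.
apply: (near_eq_is_derive E); apply: (is_deriveD (DB i j)).
have dt : is_derive x (e_ i) (fun z => lee_form z 0 j) (dtau i 0 j).
  by have /is_derive_mxP := Dtau i; apply.
have dr : is_derive x (e_ i) (fun z => row j (g z)) (row j (dg i)).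
  have /is_derive_mxP D := Dg i Vx; apply/is_derive_mxP => a b; rewrite mxE.
  have -> : (fun z => row j (g z) a b) = (fun z => g z j b) by apply/funext => z; rewrite mxE.
  exact: D.
have d1 := is_derive_scalemx dt (is_derive_cst (1%:M : 'M[R]_4) x (e_ i)).
have d2 := is_derive_mulmx (is_derive_cst (e_ j) x (e_ i)) (Dtau i).
have d3 := is_derive_mulmx (Du i) dr.
apply: (is_derive_eq (is_deriveZ 2^-1 (is_deriveB (is_deriveD d1 d2) d3))).
by rewrite /dweyl_shift scaler0 addr0 mul0mx add0r.
Qed.

Let Rm i j := 'D_(e_ i) (christoffel_mx j) x - 'D_(e_ j) (christoffel_mx i) x
  + (christoffel_mx i x *m christoffel_mx j x - christoffel_mx j x *m christoffel_mx i x).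

Let riemann_upE l k i j : riemann_up g l k i j x = Rm i j l k.
Proof.
have D a b : partial a (christoffel g l b k) x = 'D_(e_ a) (christoffel_mx b) x l k.
  have E : christoffel g l b k = (fun y => christoffel_mx b y l k).
    by apply/funext => y; rewrite mxE.
  have [dG _] := dGamma a b; have /is_derive_mxP/(_ l k)[_ e] := derivableP dG.
  exact: etrans (congr1 (fun f => 'D_(e_ a) f x) E) e.
rewrite /riemann_up !D /Rm !mxE_lin; congr (_ + _).
rewrite sumrB; congr (_ - _); rewrite [RHS]mxE; apply: eq_bigr => m _.
  by rewrite !mxE.
by rewrite !mxE.
Qed.

Let RmE i j : Rm i j = Q i j + 2^-1 *: (t i j *: 1%:M)
  + kulkarni_nomizu (g x) (shift_schouten (g x) Bx tau u dtau) i j.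
Proof.
rewrite -(weyl_shift_curvature dB (nc_sym h) (nc_unit h) torsionfree
  (fun l => metric_derive l Vx) (lee_formE Vx) dtauE).
have dGE a b : 'D_(e_ a) (christoffel_mx b) x = dB a b + dweyl_shift (g x) u dtau du dg a b.
  by have [] := dGamma a b.
by rewrite /Rm (dGE i j) (dGE j i) (christoffel_mxE i Vx) (christoffel_mxE j Vx).
Qed.

Let QC i j : Q j i = - Q i j.
Proof. exact: curvature_antisym. Qed.

Let Q1 i j : J1 x *m Q i j = Q i j *m J1 x.
Proof. by apply: comm => // k z Vz; have [] := obata_field_parallel k Vz. Qed.

Let Q2 i j : J2 x *m Q i j = Q i j *m J2 x.
Proof. by apply: comm => // k z Vz; have [] := obata_field_parallel k Vz. Qed.

Let bianchi := curvature_bianchi torsionfree dtorsionfree.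

Lemma weylE a b c d : weyl g a b c d x = (g x *m weyl_mx (g x) Q t c d) a b.
Proof.
rewrite (low_weyl_mx h).
rewrite -(weyl_decomposition (nc_sym h) (nc_unit h) (ricci_mxE h QC Q1 Q2 bianchi metricity)
  (skew_shift_schouten tau u dtau (nc_sym h) torsionfree) RmE).
have ric k j : ricci g k j x = \sum_i Rm i j i k.
  by apply: eq_bigr => i _; rewrite riemann_upE.
rewrite /weyl !ric; congr (_ - _ + _ * _ * _).
  by rewrite /riemann [RHS]mxE; apply: eq_bigr => l _; rewrite riemann_upE.
by apply: eq_bigr => k _; apply: eq_bigr => j _; rewrite ric.
Qed.

Lemma weyl_plus_eq0 a b c d : weyl_plus g (o x) a b c d x = 0.
Proof.
have [sd1 sd2 sd3] := sd Vx.
rewrite /weyl_plus; set w := (\matrix_(_, _) _).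
have -> : w = g x *m weyl_mx (g x) Q t c d.
  by apply/matrixP => i j; rewrite mxE weylE.
rewrite weylE (weyl_mx_asd h QC Q1 Q2 bianchi metricity c d sd1 sd2 sd3).
by rewrite mxE_opp subrr mulr0.
Qed.

End AtPoint.
End Local.

(** * Charts *)

Section Charts.
Context {R : realType} {M : manifold4 R}.
Implicit Types (U : set M) (i : index M).

Lemma local_domP U i x : local_dom U i x ->
  U (param (atlas i) x) /\ dom (atlas i) (param (atlas i) x).
Proof. by move=> [p [Up dp] <-]; rewrite coordK. Qed.

Lemma local_dom_subset U W i : U `<=` W -> local_dom U i `<=` local_dom W i.
Proof. by move=> sub x [p [Up dp] <-]; exists p => //; split=> //; apply: sub. Qed.

(** Inside the open image of the chart, membership is the condition that [param] lands in [U], which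
    is open by continuity. *)
Lemma local_dom_open U i : open U -> open (local_dom U i).
Proof.
move=> oU; rewrite openE => x [p [Up dp] <-].
have im : (coord (atlas i) @` dom (atlas i)) (coord (atlas i) p) by exists p.
have nU : nbhs (param (atlas i) (coord (atlas i) p)) U.
  by rewrite coordK //; apply: open_nbhs_nbhs.
have nI : nbhs (coord (atlas i) p) (coord (atlas i) @` dom (atlas i)).
  by apply: open_nbhs_nbhs; split => //; exact: image_open.
have nP : nbhs (coord (atlas i) p) [set y | U (param (atlas i) y)].
  exact: (param_continuous im nU).
apply: (filterS _ (filterI nP nI)) => y [/= Uy [q dq qy]].
by exists q => //; split=> //; move: Uy; rewrite -qy coordK.
Qed.
End Charts.

Theorem theorem6p2 (R : realType) (M : manifold4 R) (D : set M)
    (J1 J2 J3 : field2 M) (hD : open D)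
    (hJ : hyper_paracomplex D J1 J2 J3) :
  anti_self_dual_structure D J1 J2 J3.
Proof.
move=> U g o oU UD [hg cg] [ho co] i p Up dp a b c d.
have [sg _ gS gU] := hg; have [f1 f2 f3 alg n1 n2 n3] := hJ.
have pK : param (atlas i) (coord (atlas i) p) = p by rewrite coordK.
have V0 : local_dom U i (coord (atlas i) p) by exists p.
have sub := local_dom_subset (i := i) UD.
have smooth J : endomorphism_field D J -> smooth_mx (local_dom U i) (local_rep J i).
  by move=> [sJ _]; apply: smooth_mx_subset sub (sJ i).
have nij J x X Y : integrable_on D J -> local_dom U i x ->
    nijenhuis (local_rep J i) (fun=> X) (fun=> Y) x = 0.
  by move=> nJ Vx; apply: (nJ i) (sub _ Vx); apply: smooth_mx_cst.
(* The local result takes the orientation as a function of the coordinates. *)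
rewrite -[in o i p]pK.
apply: (@weyl_plus_eq0 R (local_dom U i) (local_rep g i) (local_rep J1 i)
  (local_rep J2 i) (local_rep J3 i) (fun y => o i (param (atlas i) y))) => //;
  try exact: smooth; try (by move=> y X Y; exact: nij); first exact: local_dom_open.
- move=> y /local_domP[Uy dy]; rewrite /local_rep.
  have [j11 j22 j33 j12 j21] := alg i _ (UD _ Uy) dy.
  have [c1 c2 c3] := cg i _ Uy dy.
  (* Multiplying the compatibility condition by [K] on the right linearizes it; the sign [e] is 1
     for [J1] and [J2], and -1 for [J3]. *)
  have skew (G K : 'M[R]_4) (e : R) : K *m K = e%:M -> e * e = 1 -> K^T *m G *m K = - (e *: G) ->
      K^T *m G = - (G *m K).
    move=> KK ee KG; rewrite -[LHS]scale1r -ee -scalerA -[e *: (K^T *m G)]mul_mx_scalar -KK.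
    by rewrite mulmxA KG mulNmx scalerN -scalemxAl scalerA ee scale1r.
  split; first exact: gS; first exact: gU; first by split.
  + by apply: (skew _ _ 1) => //; rewrite ?mulr1 // scale1r.
  + by apply: (skew _ _ 1) => //; rewrite ?mulr1 // scale1r.
  + apply: (skew _ _ (-1)); rewrite ?mulrNN ?mulr1 //; first by rewrite j33 raddfN.
    by rewrite c3 scaleN1r opprK.
- by move=> y /local_domP[Uy dy]; exact: co.
Qed.
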